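(* Let $\mathcal{A}=(A,+)$ be a finite semilattice and let $\operatorname{End}(\mathcal{A})$ be its endomorphism semiring. Then $\operatorname{End}(\mathcal{A})$ is finitely based if and only if $|A|\in\{1,2\}$. Moreover, $\operatorname{End}(\mathcal{A})$ is inherently nonfinitely based if the height of $\mathcal{A}$ is at least $3$, and $\operatorname{End}(\mathcal{A})$ is strongly nonfinitely based if $|A|\ge 5$.
   Context: A semiring is an algebra $(S,+,\cdot)$ with $(S,+)$ a commutative semigroup, $(S,\cdot)$ a semigroup, and both distributive laws. A semilattice is a commutative idempotent semigroup $(A,+)$; it carries the partial order $a\leqslant a'\iff a+a'=a'$, in which $a+b$ is the least upper bound of $a,b$. An additively idempotent semiring (ai-semiring) is a semiring whose additive reduct is a semilattice. For a semilattice $\mathcal{A}=(A,+)$, $\operatorname{End}(\mathcal{A})$ is the set of all maps $\alpha:A\to A$ with $(a+b)\alpha=a\alpha+b\alpha$, made into an ai-semiring by pointwise addition $a(\alpha+\beta)=a\alpha+a\beta$ and composition $a(\alpha\beta)=(a\alpha)\beta$. The height of a finite semilattice is the maximal size of a chain in $(A,\leqslant)$. Semiring polynomials are built from words over a countably infinite set of variables using $+$ and $\cdot$; an identity $p=p'$ holds in an ai-semiring if both sides take equal values under every substitution of elements for variables. The variety $\operatorname{var}\mathcal{S}$ generated by $\mathcal{S}$ is the class of ai-semirings satisfying all identities of $\mathcal{S}$. An ai-semiring is finitely based if $\operatorname{var}\mathcal{S}$ can be defined by a finite set of identities, and nonfinitely based otherwise. A variety is locally finite if each finitely generated member is finite;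 a locally finite variety is inherently nonfinitely based if it is not contained in any finitely based locally finite variety, and an ai-semiring is inherently nonfinitely based if $\operatorname{var}\mathcal{S}$ is. A finite ai-semiring is strongly nonfinitely based if it does not belong to any variety that is both generated by a finite ai-semiring and finitely based. *)

(* Defs.v *)
From mathcomp Require Import all_boot.
From Stdlib Require List.
Import List.ListNotations.

Set Implicit Arguments.
Unset Strict Implicit.
Unset Printing Implicit Defensive.

Record aiSemiring := AiSemiring {
  ai_car : Type;
  ai_add : ai_car -> ai_car -> ai_car;
  ai_mul : ai_car -> ai_car -> ai_car;
  ai_addA : forall x y z, ai_add x (ai_add y z) = ai_add (ai_add x y) z;
  ai_addC : forall x y, ai_add x y = ai_add y x;
  ai_addI : forall x, ai_add x x = x;
  ai_mulA : forall x y z, ai_mul x (ai_mul y z) = ai_mul (ai_mul x y) z;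
  ai_mulDr : forall x y z, ai_mul x (ai_add y z) = ai_add (ai_mul x y) (ai_mul x z);
  ai_mulDl : forall x y z, ai_mul (ai_add x y) z = ai_add (ai_mul x z) (ai_mul y z)
}.

Inductive term : Type :=
  | tVar : nat -> term
  | tAdd : term -> term -> term
  | tMul : term -> term -> term.

Fixpoint eval (S : aiSemiring) (v : nat -> ai_car S) (t : term) : ai_car S :=
  match t with
  | tVar n => v n
  | tAdd p q => ai_add (eval v p) (eval v q)
  | tMul p q => ai_mul (eval v p) (eval v q)
  end.

Definition identity := (term * term)%type.

Definition holds (S : aiSemiring) (e : identity) : Prop :=
  forall v : nat -> ai_car S, eval v e.1 = eval v e.2.

Definition Mod (Sigma : list identity) (B : aiSemiring) : Prop :=
  forall e, List.In e Sigma -> holds B e.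

Definition in_var (S B : aiSemiring) : Prop :=
  forall e, holds S e -> holds B e.

Definition finitely_based (S : aiSemiring) : Prop :=
  exists Sigma : list identity, forall B : aiSemiring, in_var S B <-> Mod Sigma B.

Definition finite_ai (B : aiSemiring) : Prop :=
  exists l : list (ai_car B), forall x, List.In x l.

Definition finitely_generated (B : aiSemiring) : Prop :=
  exists gs : list (ai_car B), forall x : ai_car B,
    exists (t : term) (v : nat -> ai_car B), (forall n, List.In (v n) gs) /\ eval v t = x.

Definition locally_finite (V : aiSemiring -> Prop) : Prop :=
  forall B, V B -> finitely_generated B -> finite_ai B.

Definition inherently_nonfinitely_based (S : aiSemiring) : Prop :=
  locally_finite (in_var S) /\
  forall Sigma : list identity, locally_finite (Mod Sigma) ->
    ~ (forall B, in_var S B -> Mod Sigma B).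

Definition strongly_nonfinitely_based (S : aiSemiring) : Prop :=
  finite_ai S /\
  ~ (exists T : aiSemiring, finite_ai T /\ finitely_based T /\ in_var T S).

Record finSemilattice := FinSemilattice {
  sl_car : finType;
  sl_add : sl_car -> sl_car -> sl_car;
  sl_addA : associative sl_add;
  sl_addC : commutative sl_add;
  sl_addI : idempotent_op sl_add
}.

Section Endo.
Variable L : finSemilattice.
Local Notation A := (sl_car L).
Local Notation add := (@sl_add L).

Definition sl_le (a b : A) : bool := add a b == b.

Definition sl_chain (C : {set A}) : bool :=
  [forall x in C, forall y in C, sl_le x y || sl_le y x].

Definition height : nat := \max_(C : {set A} | sl_chain C) #|C|.

Definition is_endo (f : {ffun A -> A}) : bool :=
  [forall a, forall b, f (add a b) == add (f a) (f b)].

Definition endo := {f : {ffun A -> A} | is_endo f}.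

Lemma is_endo_add (f g : endo) :
  is_endo [ffun a => add (val f a) (val g a)].
Proof.
case: f => f Hf; case: g => g Hg.
apply/forallP => a; apply/forallP => b; rewrite !ffunE /=.
rewrite (eqP (forallP (forallP Hf a) b)) (eqP (forallP (forallP Hg a) b)).
apply/eqP.
rewrite -!(@sl_addA L); congr (add _ _).
rewrite (@sl_addC L (f b)) -!(@sl_addA L); congr (add _ _); exact: (@sl_addC L).
Qed.

(* a(alpha beta) = (a alpha) beta : first alpha, then beta *)
Lemma is_endo_mul (f g : endo) :
  is_endo [ffun a => val g (val f a)].
Proof.
case: f => f Hf; case: g => g Hg.
apply/forallP => a; apply/forallP => b; rewrite !ffunE /=.
rewrite (eqP (forallP (forallP Hf a) b)).
exact: (forallP (forallP Hg (f a)) (f b)).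
Qed.

Definition endo_add (f g : endo) : endo := exist (fun h => is_endo h) _ (is_endo_add f g).
Definition endo_mul (f g : endo) : endo := exist (fun h => is_endo h) _ (is_endo_mul f g).

Lemma endo_eq (f g : endo) : (forall a, val f a = val g a) -> f = g.
Proof. by move=> H; apply: val_inj; apply/ffunP. Qed.

Lemma endo_hom (f : endo) a b : val f (add a b) = add (val f a) (val f b).
Proof. by case: f => f /= Hf; apply/eqP; exact: (forallP (forallP Hf a) b). Qed.

Definition End_ai : aiSemiring.
Proof.
refine (@AiSemiring endo endo_add endo_mul _ _ _ _ _ _).
- by move=> f g h; apply: endo_eq => a; rewrite /= !ffunE /= ?ffunE (@sl_addA L).
- by move=> f g; apply: endo_eq => a; rewrite /= !ffunE (@sl_addC L).
- by move=> f; apply: endo_eq => a; rewrite /= !ffunE (@sl_addI L).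
- by move=> f g h; apply: endo_eq => a; rewrite /= !ffunE /= ?ffunE.
- move=> f g h; apply: endo_eq => a; rewrite /= !ffunE /= ?ffunE; done.
- move=> f g h; apply: endo_eq => a; rewrite /= !ffunE /= ?ffunE; exact: endo_hom.
Defined.

End Endo.

(* Main.v *)
Require Import Defs.
From HB Require Import structures.
From mathcomp Require Import all_boot all_fingroup all_algebra zify ring.
From Stdlib Require Import Classical ClassicalEpsilon FunctionalExtensionality PropExtensionality ProofIrrelevance.

(* The separating semirings are syntactic semirings of languages. Such a semiring satisfies
[p = p'] as soon as every substitution that sends all words of one side, in a given context,
into the language does the same for the other side.

If the height is at least 3, the identities of [End L] preserve the pairs of adjacent letters
under all substitutions. Take an infinite word whose blocks of length [k + 2] spell the word
itself (a ruler word). Among the columns of the blocks, one is never the end of the value of a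
variable, and induction on the length shows that the factors of the ruler word are isoterms for
the identities of [End L] in [k] variables. The syntactic semiring of its prefixes is finitely
generated and infinite, so finitely many identities of [End L] never define a locally finite
variety.

If the height is 2, the semilattice is flat: a top element above an antichain. Its identities
only see whether a set of letters occurs 0, 1 or more times. A linear hypergraph with large
edges, all of whose colourings by [End L] have a monochromatic edge, yields an identity of
[End L] that fails in the syntactic semiring of the permutations of the edges, although this
semiring satisfies the identities of [End L] in [k] variables. When the antichain has at least
four elements, [End L] contains the dihedral group of order 8, and the hypergraph can be replaced
with a group of class two over the field with two elements. Its subgroups on [k] generators are
controlled by the dihedral group, but it distinguishes words that are equal in every semiring
with at most [t] elements. *)

Set Implicit Arguments.
Unset Strict Implicit.
Unset Printing Implicit Defensive.


(** A finite basis uses only [k] variables for some [k], so it suffices to find a semiring that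
    satisfies the [k]-variable identities of [End L] and still misbehaves. The obstacle is that a
    variable may stand for a long word, or for a set of words. Cancellation, or the linearity of the
    hypergraph, reduces sets to single words; then [k] enters by counting. The values of [k]
    variables end in at most [k] columns, and the last column is excluded because its right
    neighbour lies in another block: hence blocks of length [k + 2]. Inside an edge at most [k + 1]
    letters stand alone, as the value of a variable or as the context: hence longer edges. In the
    group, [k] elements span a subspace of dimension at most [k], while the form that defines the
    group only kills block scalar matrices of size [k + 1]. The hypergraph identity is tailored to
    [End L], so it says nothing about an unknown finite semiring [T] whose variety contains [End L].
    Only the size of [T] is known, and the group identity has to hold in [T] by pigeonhole. *)

Fixpoint words (t : term) : seq (seq nat) :=
  match t with
  | tVar n => [:: [:: n]]
  | tAdd p q => words p ++ words q
  | tMul p q => [seq u ++ w | u <- words p, w <- words q]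
  end.

Lemma words_nonnil t u : u \in words t -> u != [::].
Proof.
elim: t u => [n|p IHp q IHq|p IHp q IHq] u /=.
- by rewrite inE => /eqP->.
- by rewrite mem_cat => /orP[/IHp|/IHq].
- by case/allpairsP => -[a b] /= [/IHp + _ ->]; case: a.
Qed.

Lemma words_neq0 t : exists u, u \in words t.
Proof.
elim: t => [n|p [u Hu] q _|p [u Hu] q [w Hw]] /=.
- by exists [:: n]; rewrite inE.
- by exists u; rewrite mem_cat Hu.
- by exists (u ++ w); apply: allpairs_f.
Qed.

Fixpoint varbound (t : term) : nat :=
  match t with
  | tVar n => n.+1
  | tAdd p q | tMul p q => maxn (varbound p) (varbound q)
  end.

Lemma words_varbound t u x : u \in words t -> x \in u -> x < varbound t.
Proof.
elim: t u x => [n|p IHp q IHq|p IHp q IHq] u x /=.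
- by rewrite inE => /eqP->; rewrite inE => /eqP->.
- by rewrite mem_cat leq_max => /orP[/IHp H /H->//|/IHq H /H->]; rewrite orbT.
- case/allpairsP => -[a b] /= [Ha Hb ->]; rewrite mem_cat leq_max.
  by case/orP => [/(IHp _ _ Ha)->//|/(IHq _ _ Hb)->]; rewrite orbT.
Qed.

Definition bounded (k : nat) (e : identity) : Prop :=
  forall u x, u \in words e.1 ++ words e.2 -> x \in u -> x < k.

Lemma identities_bounded (Sigma : list identity) :
  exists k, forall e, List.In e Sigma -> bounded k e.
Proof.
elim: Sigma => [|[p q] Sigma [k Hk]]; first by exists 0.
exists (maxn k (maxn (varbound p) (varbound q))) => e /= [<-|/Hk H] u x Hu Hx.
  rewrite !leq_max; move: Hu; rewrite mem_cat /=.
  by case/orP => /words_varbound/(_ Hx) ->; rewrite ?orbT.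
by rewrite leq_max (H _ _ Hu Hx).
Qed.

(** * The natural order and the values of words *)

Section Order.
Variable B : aiSemiring.
Implicit Types x y z : ai_car B.

Definition ai_le x y := ai_add x y = y.

Lemma ai_le_anti x y : ai_le x y -> ai_le y x -> x = y.
Proof. by rewrite /ai_le ai_addC => -> ->. Qed.

Lemma ai_le_trans x y z : ai_le x y -> ai_le y z -> ai_le x z.
Proof. by rewrite /ai_le => Hxy Hyz; rewrite -Hyz ai_addA Hxy. Qed.

Lemma ai_le_refl x : ai_le x x.
Proof. exact: ai_addI. Qed.

Lemma ai_le_addl x y : ai_le x (ai_add x y).
Proof. by rewrite /ai_le ai_addA ai_addI. Qed.

Lemma ai_le_addr x y : ai_le y (ai_add x y).
Proof. by rewrite ai_addC; apply: ai_le_addl. Qed.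

Lemma ai_le_lub x y z : ai_le x z -> ai_le y z -> ai_le (ai_add x y) z.
Proof. by rewrite /ai_le -ai_addA => Hx ->. Qed.

Lemma ai_le_mull x y z : ai_le x y -> ai_le (ai_mul z x) (ai_mul z y).
Proof. by rewrite /ai_le -ai_mulDr => ->. Qed.

Lemma ai_le_mulr x y z : ai_le x y -> ai_le (ai_mul x z) (ai_mul y z).
Proof. by rewrite /ai_le -ai_mulDl => ->. Qed.

Variable v : nat -> ai_car B.

(* The value on the empty word is junk. *)
Fixpoint wval (u : seq nat) : ai_car B :=
  match u with
  | [::] => v 0
  | [:: x] => v x
  | x :: u' => ai_mul (v x) (wval u')
  end.

Lemma wval_cons (x : nat) u : u != [::] -> wval (x :: u) = ai_mul (v x) (wval u).
Proof. by case: u. Qed.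

Lemma wval_cat u w : u != [::] -> w != [::] ->
  wval (u ++ w) = ai_mul (wval u) (wval w).
Proof.
elim: u => // x [|y u] IH _ Hw; first by rewrite cat1s wval_cons.
by rewrite cat_cons wval_cons // IH // ai_mulA.
Qed.

Lemma wval_le_eval t u : u \in words t -> ai_le (wval u) (eval v t).
Proof.
elim: t u => [n|p IHp q IHq|p IHp q IHq] u /=.
- by rewrite inE => /eqP->; apply: ai_le_refl.
- rewrite mem_cat => /orP[/IHp H|/IHq H]; apply: (ai_le_trans H).
    exact: ai_le_addl.
  exact: ai_le_addr.
- case/allpairsP => -[a b] /= [Ha Hb ->].
  rewrite wval_cat ?(words_nonnil Ha) ?(words_nonnil Hb) //.
  exact: ai_le_trans (ai_le_mulr _ (IHp _ Ha)) (ai_le_mull _ (IHq _ Hb)).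
Qed.

(** The additive map [f] is generalised in the induction: in a product, multiplication by the other
    factor is absorbed into [f]. With [f] the identity this gives least upper bounds in [B]; with
    [f] the evaluation of endomorphisms at a point it gives bounds at that point. *)
Lemma eval_least (D : Type) (op : D -> D -> D) (f : ai_car B -> D) (c : D) t :
  associative op -> (forall x y, f (ai_add x y) = op (f x) (f y)) ->
  (forall u, u \in words t -> op (f (wval u)) c = c) -> op (f (eval v t)) c = c.
Proof.
move=> opA; elim: t f => [n|p IHp q IHq|p IHp q IHq] f fD H /=.
- by apply: (H [:: n]); rewrite inE.
- by rewrite fD -opA IHq ?IHp // => u Hu; apply: H; rewrite mem_cat Hu ?orbT.
- apply: (IHp (fun z => f (ai_mul z (eval v q)))) => [x y|u Hu].
    by rewrite ai_mulDl fD.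
  apply: (IHq (fun z => f (ai_mul (wval u) z))) => [x y|w Hw].
    by rewrite ai_mulDr fD.
  by rewrite -wval_cat ?(words_nonnil Hu) ?(words_nonnil Hw) //; apply/H/allpairs_f.
Qed.

Lemma eval_lub t c :
  (forall u, u \in words t -> ai_le (wval u) c) -> ai_le (eval v t) c.
Proof. by move=> H; apply: (@eval_least _ (@ai_add B) id) => //; apply: ai_addA. Qed.

End Order.

Fixpoint word_term (x : nat) (u : seq nat) : term :=
  if u is y :: u' then tMul (tVar x) (word_term y u') else tVar x.

Definition term_of (u : seq nat) : term := word_term (head 0 u) (behead u).

Lemma words_term_of u : u != [::] -> words (term_of u) = [:: u].
Proof.
case: u => // x u _; rewrite /term_of /=.
by elim: u x => //= y u IH x; rewrite IH.
Qed.

Lemma eval_term_of (B : aiSemiring) (v : nat -> ai_car B) u :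
  u != [::] -> eval v (term_of u) = wval v u.
Proof.
case: u => // x u _; rewrite /term_of /=.
by elim: u x => //= y u IH x; rewrite IH.
Qed.

Definition sum_term (us : seq (seq nat)) : term :=
  foldr (fun u t => tAdd (term_of u) t) (term_of (head [::] us)) (behead us).

Lemma mem_words_sum_term us : us != [::] -> [::] \notin us ->
  words (sum_term us) =i us.
Proof.
case: us => // u us _; rewrite inE negb_or eq_sym => /andP[u0 us0] w; rewrite /sum_term /=.
have -> : words (foldr (fun u t => tAdd (term_of u) t) (term_of u) us) =i rcons us u.
  elim: us us0 => [_ z|u' us IH]; first by rewrite /= words_term_of.
  rewrite inE negb_or eq_sym => /andP[u'0 us0] z; rewrite /= words_term_of //=.
  by rewrite inE IH // inE.
by rewrite mem_rcons.
Qed.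

Lemma in_var_trans (S T U : aiSemiring) : in_var S T -> in_var T U -> in_var S U.
Proof. by move=> H K e /H/K. Qed.

(** * Varieties generated by finite semirings are locally finite *)

Lemma list_nthE (T : Type) (d : T) (l : seq T) i : List.nth i l d = nth d l i.
Proof. by elim: l i => [|x l IH] [|i] //=. Qed.

Lemma finite_ai_enum (S : aiSemiring) : finite_ai S ->
  exists (n : nat) (f : 'I_n -> ai_car S) (g : ai_car S -> 'I_n), cancel g f.
Proof.
case=> l Hl; have [x0|no] := classic (inhabited (ai_car S)); last first.
  exists 0, (fun i : 'I_0 => False_rect _ (notF (ltn_ord i))).
  by exists (fun x => False_rect _ (no (inhabits x))) => x; case: no.
case: x0 => x0; exists (size l), (fun i => nth x0 l i).
have Hg x : exists i : 'I_(size l), nth x0 l i = x.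
  have [i [/ltP Hi <-]] := List.In_nth l x x0 (Hl x).
  by exists (Ordinal Hi); rewrite list_nthE.
exists (fun x => proj1_sig (constructive_indefinite_description _ (Hg x))) => x.
by case: constructive_indefinite_description.
Qed.

Lemma in_inE (T : eqType) (x : T) (s : seq T) : List.In x s <-> x \in s.
Proof.
elim: s => //= y s IH; rewrite inE; split.
  by case=> [->|/IH->]; rewrite ?eqxx ?orbT.
by case/orP => [/eqP->|/IH]; [left | right].
Qed.

Lemma in_map_seq (T U : Type) (f : T -> U) x (s : seq T) :
  List.In x s -> List.In (f x) (map f s).
Proof. by elim: s => //= y s IH [->|/IH]; [left | right]. Qed.

Fixpoint tsubst (tau : nat -> term) (t : term) : term :=
  match t with
  | tVar n => tau n
  | tAdd p q => tAdd (tsubst tau p) (tsubst tau q)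
  | tMul p q => tMul (tsubst tau p) (tsubst tau q)
  end.

Lemma eval_tsubst (B : aiSemiring) (v : nat -> ai_car B) tau t :
  eval v (tsubst tau t) = eval (fun n => eval v (tau n)) t.
Proof. by elim: t => //= p -> q ->. Qed.

Lemma eval_ext (B : aiSemiring) (v w : nat -> ai_car B) t :
  (forall n, v n = w n) -> eval v t = eval w t.
Proof. by move=> H; elim: t => //= p -> q ->. Qed.

Lemma in_var_locally_finite (S : aiSemiring) : finite_ai S -> locally_finite (in_var S).
Proof.
case/finite_ai_enum => n [f [g fK]] B HB [gs Hgs].
have [[x0]|no] := classic (inhabited (ai_car B)); last first.
  by exists nil => x; case: no.
set m := size gs; pose vg i := nth x0 gs i.
have Hx x : exists t, x = eval vg (tsubst (fun i => tVar (i %% m)) t).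
  have [t [v [Hv <-]]] := Hgs x.
  have Hi j : exists i, vg (i %% m) = v j.
    have [i [/ltP Hi Hij]] := List.In_nth gs _ x0 (Hv j).
    exists i; by rewrite modn_small // -Hij list_nthE.
  pose h j := proj1_sig (constructive_indefinite_description _ (Hi j)).
  exists (tsubst (fun j => tVar (h j)) t); rewrite !eval_tsubst /=; apply: eval_ext => j.
  by rewrite /h; case: constructive_indefinite_description.
(* A term in the generators is coded by the function it induces on the finite semiring. Terms with
   equal codes form an identity of [S], so they have the same value in [B], and there are finitely
   many codes. *)
pose code t : {ffun {ffun 'I_m.+1 -> 'I_n} -> 'I_n} :=
  [ffun a : {ffun 'I_m.+1 -> 'I_n} => g (eval (fun i => f (a (inord (i %% m)))) t)].
have code_eq t1 t2 : code t1 = code t2 ->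
    eval vg (tsubst (fun i => tVar (i %% m)) t1) = eval vg (tsubst (fun i => tVar (i %% m)) t2).
  move=> E; apply: (HB (_, _)) => v /=; rewrite !eval_tsubst /=.
  have [m0|m_gt0] := posnP m; last first.
    pose a := [ffun i : 'I_m.+1 => g (v i)].
    have := congr1 (fun c : {ffun _ -> _} => f (c a)) E; rewrite !ffunE !fK.
    have E' t : eval (fun i => f (a (inord (i %% m)))) t = eval (fun i => v (i %% m)) t.
      apply: eval_ext => i; rewrite ffunE fK inordK //.
      by apply: ltnW; rewrite ltnS ltn_pmod.
    by rewrite !E'.
  have [i []] := Hgs x0; move: m0; rewrite /m; case: (gs) => //= _ w [] /(_ 0) [].
pose dec c := if excluded_middle_informative (exists t, code t = c) is left H
  then eval vg (tsubst (fun i => tVar (i %% m)) (proj1_sig (constructive_indefinite_description _ H)))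
  else x0.
exists (map dec (enum {: {ffun {ffun 'I_m.+1 -> 'I_n} -> 'I_n}})) => x.
have [t ->] := Hx x; rewrite (_ : eval _ _ = dec (code t)).
  by apply: in_map_seq; apply/in_inE; rewrite mem_enum.
rewrite /dec; case: excluded_middle_informative => [H|[]]; last by exists t.
by case: constructive_indefinite_description => t' /= /code_eq.
Qed.

Lemma in_var_Mod (S : aiSemiring) Sigma :
  (forall B, in_var S B <-> Mod Sigma B) -> Mod Sigma S.
Proof. by move=> /(_ S) H; apply/H. Qed.

Lemma INFB_not_FB S : inherently_nonfinitely_based S -> ~ finitely_based S.
Proof.
case=> lf H [Sigma HS]; apply: (H Sigma) => [B /HS|B /HS//]; exact: lf.
Qed.

Lemma INFB_SNFB S : finite_ai S -> inherently_nonfinitely_based S ->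
  strongly_nonfinitely_based S.
Proof.
move=> finS [_ H]; split=> // -[T [finT [[Sigma HT] TS]]].
apply: (H Sigma) => [B /HT|B SB]; first exact: in_var_locally_finite.
by apply/HT; apply: in_var_trans SB.
Qed.

Lemma End_finite (L : finSemilattice) : finite_ai (End_ai L).
Proof. by exists (enum {: endo L}) => x; apply/in_inE; rewrite mem_enum. Qed.

(** * The syntactic semiring of a family of languages *)

Section Syntactic.
Variables (I : Type) (Wd : I -> seq nat -> Prop).

(* A term is identified with the set of contexts [l _ r] that put all of its words into [Wd i]. *)
Definition contexts (t : term) : I * seq nat * seq nat -> Prop :=
  fun c => forall w, w \in words t -> Wd c.1.1 (c.1.2 ++ w ++ c.2).

Definition syn_car := {c | exists t, contexts t = c}.

Definition syn_of (t : term) : syn_car := exist _ (contexts t) (ex_intro _ t erefl).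

Definition syn_rep (x : syn_car) : term :=
  proj1_sig (constructive_indefinite_description _ (proj2_sig x)).

Lemma syn_ofP t1 t2 : (forall i l r,
  (forall w, w \in words t1 -> Wd i (l ++ w ++ r)) <->
  (forall w, w \in words t2 -> Wd i (l ++ w ++ r))) -> syn_of t1 = syn_of t2.
Proof.
move=> H; apply: eq_sig_hprop => [c p q|]; first exact: proof_irrelevance.
apply: functional_extensionality => -[[i l] r] /=.
by apply: propositional_extensionality; apply: H.
Qed.

Lemma syn_of_inj t1 t2 i l r : syn_of t1 = syn_of t2 ->
  (forall w, w \in words t1 -> Wd i (l ++ w ++ r)) ->
  (forall w, w \in words t2 -> Wd i (l ++ w ++ r)).
Proof. by move/(congr1 (@proj1_sig _ _)) => /= /(congr1 (@^~ (i, l, r))) /= E; rewrite -/(contexts t2 (i, l, r)) -E. Qed.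

Lemma syn_repK x : syn_of (syn_rep x) = x.
Proof.
apply: eq_sig_hprop => [c p q|]; first exact: proof_irrelevance.
by rewrite /syn_rep; case: constructive_indefinite_description.
Qed.

Definition syn_add x y := syn_of (tAdd (syn_rep x) (syn_rep y)).
Definition syn_mul x y := syn_of (tMul (syn_rep x) (syn_rep y)).

Lemma syn_ofD t1 t2 : syn_add (syn_of t1) (syn_of t2) = syn_of (tAdd t1 t2).
Proof.
have E1 := syn_repK (syn_of t1); have E2 := syn_repK (syn_of t2).
apply: syn_ofP => i l r /=; split=> H w; rewrite mem_cat => /orP[].
- by apply: (syn_of_inj E1) => {}w Hw; apply: H; rewrite mem_cat Hw.
- by apply: (syn_of_inj E2) => {}w Hw; apply: H; rewrite mem_cat Hw orbT.
- by apply: (syn_of_inj (esym E1)) => {}w Hw; apply: H; rewrite mem_cat Hw.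
- by apply: (syn_of_inj (esym E2)) => {}w Hw; apply: H; rewrite mem_cat Hw orbT.
Qed.

Lemma syn_of_mul_congr t1 t1' t2 t2' i l r : syn_of t1 = syn_of t1' -> syn_of t2 = syn_of t2' ->
  (forall w, w \in words (tMul t1 t2) -> Wd i (l ++ w ++ r)) ->
  (forall w, w \in words (tMul t1' t2') -> Wd i (l ++ w ++ r)).
Proof.
move=> E1 E2 H w /= /allpairsP[[a b] /= [Ha Hb ->]].
have H1 z : z \in words t2 -> Wd i (l ++ a ++ z ++ r).
  move=> Hz; move: a Ha; apply: (syn_of_inj E1) => a Ha.
  by rewrite (catA a); apply/H/allpairs_f.
rewrite -(catA a) (catA l).
by move: b Hb; apply: (syn_of_inj E2) => b /H1; rewrite catA.
Qed.

Lemma syn_ofM t1 t2 : syn_mul (syn_of t1) (syn_of t2) = syn_of (tMul t1 t2).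
Proof.
have E1 := syn_repK (syn_of t1); have E2 := syn_repK (syn_of t2).
by apply: syn_ofP => i l r; split; apply: syn_of_mul_congr.
Qed.

Lemma syn_eq_words t1 t2 : words t1 =i words t2 -> syn_of t1 = syn_of t2.
Proof. by move=> E; apply: syn_ofP => i l r; split=> H w Hw; apply: H; rewrite ?E // -E. Qed.

Definition syn : aiSemiring.
Proof.
refine (@AiSemiring syn_car syn_add syn_mul _ _ _ _ _ _);
  do ?[move=> x; rewrite -(syn_repK x); move: (syn_rep x) => {x} ?];
  rewrite ?(syn_ofD, syn_ofM); apply: syn_eq_words => w /=.
- by rewrite catA.
- by rewrite !mem_cat orbC.
- by rewrite mem_cat orbb.
- apply/allpairsP/allpairsP => -[[a b] /= [Ha Hb ->]].
    case/allpairsP: Hb => -[c d] /= [Hc Hd ->].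
    by exists (a ++ c, d) => /=; rewrite catA; split=> //; apply: allpairs_f.
  case/allpairsP: Ha => -[c d] /= [Hc Hd ->].
  by exists (c, d ++ b) => /=; rewrite catA; split=> //; apply: allpairs_f.
- by rewrite mem_allpairs_catr.
- by rewrite allpairs_cat.
Defined.

Lemma eval_syn (tau : nat -> term) t :
  eval (S := syn) (fun n => syn_of (tau n)) t = syn_of (tsubst tau t).
Proof. by elim: t => //= p -> q ->; rewrite -?syn_ofD -?syn_ofM. Qed.

Fixpoint wsubst (T : nat -> seq (seq nat)) (u : seq nat) : seq (seq nat) :=
  if u is x :: u' then [seq a ++ b | a <- T x, b <- wsubst T u'] else [:: [::]].

Lemma wsubst_cat T u w :
  wsubst T (u ++ w) =i [seq a ++ b | a <- wsubst T u, b <- wsubst T w].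
Proof.
elim: u => [|x u IH] z /=; first by rewrite cats0 map_id.
apply/allpairsP/allpairsP => -[[a b] /= [Ha + ->]].
  rewrite IH => /allpairsP[[c d] /= [Hc Hd ->]].
  by exists (a ++ c, d); rewrite /= catA; split=> //; apply: allpairs_f.
case/allpairsP: Ha => -[c d] /= [Hc Hd ->] Hb.
by exists (c, d ++ b); rewrite /= catA; split=> //; rewrite IH; apply: allpairs_f.
Qed.

Lemma words_tsubst tau t w :
  (w \in words (tsubst tau t)) = has (fun u => w \in wsubst (fun n => words (tau n)) u) (words t).
Proof.
elim: t w => [n|p IHp q IHq|p IHp q IHq] w /=.
- by rewrite orbF; congr (w \in _); elim: (words _) => //= a s {1}->; rewrite cats0.
- by rewrite mem_cat has_cat IHp IHq.
- apply/allpairsP/hasP => [[[a b] /= [+ + ->]]|[u /allpairsP[[c d] /= [Hc Hd ->]]]].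
    rewrite IHp IHq => /hasP[u Hu Ha] /hasP[u' Hu' Hb].
    by exists (u ++ u'); [apply: allpairs_f | rewrite wsubst_cat; apply: allpairs_f].
  rewrite wsubst_cat => /allpairsP[[a b] /= [Ha Hb ->]].
  by exists (a, b); rewrite /= IHp IHq; split=> //; apply/hasP; [exists c | exists d].
Qed.

(** [T n] stands for the words of the term substituted for the variable [n]; this is why it has to
    be inhabited and free of the empty word. *)
Definition syn_implies (e : identity) : Prop :=
  forall (T : nat -> seq (seq nat)) i l r,
    (forall n, exists w, w \in T n) -> (forall n, [::] \notin T n) ->
    (forall u w, u \in words e.1 -> w \in wsubst T u -> Wd i (l ++ w ++ r)) ->
    (forall q w, q \in words e.2 -> w \in wsubst T q -> Wd i (l ++ w ++ r)).

Lemma syn_holds e : syn_implies e -> syn_implies (e.2, e.1) -> holds syn e.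
Proof.
move=> H1 H2 v; pose tau n := syn_rep (v n).
rewrite -!(@eval_ext syn (fun n => syn_of (tau n)) v); last 2 first.
- by move=> n; rewrite syn_repK.
- by move=> n; rewrite syn_repK.
have T0 n : exists w, w \in words (tau n) by exact: words_neq0.
have T1 n : [::] \notin words (tau n) by apply/negP => /words_nonnil.
rewrite !eval_syn; apply: syn_ofP => i l r; split=> H w; rewrite words_tsubst.
  case/hasP => u Hu Hw; apply: H1 Hu Hw => // {}u {}w Hu Hw; apply: H.
  by rewrite words_tsubst; apply/hasP; exists u.
case/hasP => u Hu Hw; apply: (H2) Hu Hw => // {}u {}w Hu Hw; apply: H.
by rewrite words_tsubst; apply/hasP; exists u.
Qed.

Lemma wsubstP T u w : w \in wsubst T u <->
  exists2 cs, all2 (fun x a => a \in T x) u cs & w = flatten cs.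
Proof.
elim: u w => [|x u IH] w /=.
  rewrite inE; split=> [/eqP->|[[|] // _ ->] //]; by exists [::].
split=> [/allpairsP[[a b] /= [Ha /IH[cs Hcs ->] ->]]|[[|a cs] //= /andP[Ha Hcs] ->]].
  by exists (a :: cs); rewrite //= Ha.
by apply: allpairs_f => //; apply/IH; exists cs.
Qed.

Lemma wsubst_fun (T : nat -> seq (seq nat)) (c : nat -> seq nat) u :
  (forall n, c n \in T n) -> flatten (map c u) \in wsubst T u.
Proof. by move=> H; elim: u => //= x u IH; apply: allpairs_f. Qed.

End Syntactic.

(** * Languages given by the value in a cancellative monoid *)

Section Monoid.
Variables (X : Type) (op : X -> X -> X) (one : X).
Hypotheses (opA : associative op) (op1x : left_id one op).

Definition mprod (g : nat -> X) (u : seq nat) : X := foldr (fun x y => op (g x) y) one u.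

Lemma mprod_cat g u w : mprod g (u ++ w) = op (mprod g u) (mprod g w).
Proof. by elim: u => [|x u IH] /=; rewrite ?op1x // /mprod /= -/(mprod _ _) IH opA. Qed.

Lemma mprod_flatten g c u : mprod g (flatten (map c u)) = mprod (fun x => mprod g (c x)) u.
Proof. by elim: u => //= x u IH; rewrite mprod_cat IH. Qed.

Hypothesis cancel2 : forall l r x y, op l (op x r) = op l (op y r) -> x = y.

(** A variable of [q] also occurs in some word of the left side. Exchanging its value there for
    another word of [T x] does not change the product, so by cancellation all words of [T x] have
    the same value in the monoid. A substitution of sets thus acts as a single assignment [h]. *)
Lemma syn_monoid_implies (g : nat -> X) (target : X -> Prop) (e : identity) :
  (forall q x, q \in words e.2 -> x \in q -> exists2 u, u \in words e.1 & x \in u) ->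
  (forall (h : nat -> X) l r i, target i ->
     (forall u, u \in words e.1 -> op l (op (mprod h u) r) = i) ->
     forall q, q \in words e.2 -> op l (op (mprod h q) r) = i) ->
  syn_implies (fun i w => target i /\ mprod g w = i) e.
Proof.
move=> cont H T i l r T0 T1 HU q w Hq Hw.
pose c n := proj1_sig (constructive_indefinite_description _ (T0 n)).
have Hc n : c n \in T n by rewrite /c; case: constructive_indefinite_description.
have [u0 Hu0] := words_neq0 e.1.
have [ti _] := HU _ _ Hu0 (wsubst_fun u0 Hc).
have same x a : x \in q -> a \in T x -> mprod g a = mprod g (c x).
  move=> /(cont _ _ Hq)[u Hu xu] Ha.
  case/splitPr: xu Hu => u1 u2 Hu.
  have Hmem b : b \in T x -> flatten (map c u1) ++ b ++ flatten (map c u2) \in wsubst T (u1 ++ x :: u2).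
    move=> Hb; rewrite wsubst_cat; apply: allpairs_f; first exact: wsubst_fun.
    by apply: allpairs_f => //; apply: wsubst_fun.
  have [_ E1] := HU _ _ Hu (Hmem _ Ha); have [_ E2] := HU _ _ Hu (Hmem _ (Hc x)).
  move: E1; rewrite -{}E2 !mprod_cat -!opA !(opA (mprod g l)).
  exact: cancel2.
split=> //; rewrite !mprod_cat.
have -> : mprod g w = mprod (fun x => mprod g (c x)) q.
  have [cs + ->] := (wsubstP _ _ _).1 Hw.
  have {}same := fun x (xq : x \in q) a => same x a xq.
  elim: (q) cs same => [|x q' IH] [|a cs] //= same /andP[Ha Hcs].
  rewrite mprod_cat (same x) ?mem_head // IH // => y Hy a'.
  by apply: same; rewrite inE Hy orbT.
apply: H Hq => // u Hu; rewrite -mprod_flatten -!mprod_cat.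
by have [_ ->] := HU _ _ Hu (wsubst_fun u Hc).
Qed.

End Monoid.

Lemma mprod_morph (X Y : Type) (opX : X -> X -> X) (opY : Y -> Y -> Y) eX eY (f : X -> Y) g u :
  f eX = eY -> (forall x y, f (opX x y) = opY (f x) (f y)) ->
  f (mprod opX eX g u) = mprod opY eY (f \o g) u.
Proof. by move=> f1 fM; elim: u => //= x u IH; rewrite /mprod /= -!/(mprod _ _ _ _) fM IH. Qed.

(** * Endomorphisms of a semilattice acting on words *)

Section Semilattice.
Variable L : finSemilattice.
Local Notation A := (sl_car L).
Local Notation le := (@sl_le L).

Lemma sl_le_refl (x : A) : le x x.
Proof. by rewrite /sl_le sl_addI. Qed.

Lemma sl_le_anti (x y : A) : le x y -> le y x -> x = y.
Proof. by rewrite /sl_le sl_addC => /eqP-> /eqP. Qed.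

Lemma sl_le_trans (x y z : A) : le x y -> le y z -> le x z.
Proof. by rewrite /sl_le => /eqP Hxy /eqP <-; rewrite sl_addA Hxy. Qed.

Lemma sl_add_le (x y z : A) : le (sl_add x y) z = le x z && le y z.
Proof.
apply/idP/andP => [H|[/eqP Hx /eqP Hy]]; last by rewrite /sl_le -sl_addA Hy Hx.
split; apply: (sl_le_trans _ H); rewrite /sl_le; first by rewrite sl_addA sl_addI.
by rewrite sl_addC -sl_addA sl_addI.
Qed.

Lemma endo_eval_le (v : nat -> endo L) t (a c : A) :
  (forall u, u \in words t -> le (val (wval (B := End_ai L) v u) a) c) ->
  le (val (eval (S := End_ai L) v t) a) c.
Proof.
move=> H; apply/eqP.
apply: (@eval_least (End_ai L) v A (@sl_add L) (fun f : endo L => val f a)).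
- exact: sl_addA.
- by move=> f g; rewrite ffunE.
- by move=> u /H /eqP.
Qed.

Lemma endo_wval_le (v : nat -> endo L) t u (a : A) : u \in words t ->
  le (val (wval (B := End_ai L) v u) a) (val (eval (S := End_ai L) v t) a).
Proof.
move=> /(@wval_le_eval (End_ai L) v) H.
by rewrite /sl_le -{2}H ffunE.
Qed.

Definition act (v : nat -> endo L) (a : A) (u : seq nat) : A := foldl (fun b x => val (v x) b) a u.

Lemma act_cat (v : nat -> endo L) a u w : act v a (u ++ w) = act v (act v a u) w.
Proof. exact: foldl_cat. Qed.

Lemma val_wval (v : nat -> endo L) u a : u != [::] ->
  val (wval (B := End_ai L) v u) a = act v a u.
Proof.
elim: u a => // x [|y u] IH a _ //.
by rewrite wval_cons // ffunE IH.
Qed.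

(* An identity of [End L] is verified pointwise, on the words of both sides. *)
Lemma endo_holds_le (e : identity) (v : nat -> endo L) (a c : A) q :
  holds (End_ai L) e -> q \in words e.2 ->
  (forall u, u \in words e.1 -> le (act v a u) c) -> le (act v a q) c.
Proof.
move=> H Hq Hc; rewrite -val_wval ?(words_nonnil Hq) //.
apply: (sl_le_trans (endo_wval_le v a Hq)); rewrite -(H v).
by apply: endo_eval_le => u Hu; rewrite val_wval ?(words_nonnil Hu) ?Hc.
Qed.

Definition endo_of (f : {ffun A -> A}) (H : is_endo f) : endo L := exist _ f H.

Lemma id_is_endo : is_endo [ffun x : A => x].
Proof. by apply/forallP => a; apply/forallP => b; rewrite !ffunE. Qed.

Definition endo_id : endo L := endo_of id_is_endo.

Lemma threshold_is_endo (t u w : A) : le u w -> is_endo [ffun x : A => if le x t then u else w].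
Proof.
move=> /eqP uw; apply/forallP => a; apply/forallP => b; rewrite !ffunE sl_add_le.
by case: (le a t); case: (le b t) => /=; rewrite ?sl_addI ?uw // sl_addC uw.
Qed.

Lemma height_chain : 3 <= height L ->
  exists a0 a1 a2 : A, [/\ le a0 a1, le a1 a2, a0 != a1 & a1 != a2].
Proof.
move=> Hh; have [C chC cardC] : exists2 C : {set A}, sl_chain C & 2 < #|C|.
  apply: NNPP => no; move: Hh; rewrite leqNgt => /negP; apply.
  rewrite ltnS /height; apply/bigmax_leqP => C chC; rewrite leqNgt; apply/negP => c2.
  by case: no; exists C.
have {}chC x y : x \in C -> y \in C -> le x y || le y x.
  by move=> xC yC; move/forall_inP: chC => /(_ _ xC) /forall_inP /(_ _ yC).
have /card_gt2P[x [y [z [[xC yC zC] [xy yz zx]]]]] := cardC.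
have [xz yx zy] : [/\ x != z, y != x & z != y] by rewrite !(eq_sym _ x) !(eq_sym z) eq_sym; split; rewrite // eq_sym.
case/orP: (chC _ _ xC yC) => Hxy; case/orP: (chC _ _ yC zC) => Hyz; case/orP: (chC _ _ xC zC) => Hxz.
- by exists x, y, z.
- by exists x, y, z.
- by exists x, z, y.
- by exists z, x, y.
- by exists y, x, z.
- by exists y, z, x.
- by exists z, y, x.
- by exists z, y, x.
Qed.

End Semilattice.

Lemma holds_sym B e : holds B e -> holds B (e.2, e.1).
Proof. by move=> H v; rewrite H. Qed.

(** * Adjacent letters in the words of an identity *)

(** With a marker at both ends, adjacent pairs also record the first and the last letter, and the
    emptiness of the word. *)
Definition ends (K : Type) (s : seq K) : seq (option K) := None :: rcons (map Some s) None.

(* [follows U q] uses arbitrary substitutions, possibly erasing, so it is stable under deleting variables and under refining a variable into a word. *)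
Definition follows (U : seq (seq nat)) (q : seq nat) : Prop :=
  forall (K : eqType) (psi : nat -> seq K) (x y : option K),
    infix [:: x; y] (ends (flatten (map psi q))) ->
    exists2 u, u \in U & infix [:: x; y] (ends (flatten (map psi u))).

Section Follows.
Variables (L : finSemilattice) (a0 a1 a2 : sl_car L).
Local Notation le := (@sl_le L).
Hypotheses (le01 : le a0 a1) (le12 : le a1 a2) (ne01 : a0 != a1) (ne12 : a1 != a2).

Let le02 : le a0 a2. Proof. exact: sl_le_trans le12. Qed.
Let nle10 : ~~ le a1 a0.
Proof. by apply: contraNN ne01 => H; apply/eqP/sl_le_anti. Qed.
Let nle21 : ~~ le a2 a1.
Proof. by apply: contraNN ne12 => H; apply/eqP/sl_le_anti. Qed.
Let nle20 : ~~ le a2 a0.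
Proof. by apply: contraNN nle21 => H; apply: sl_le_trans le01. Qed.

Section Machine.
Variables (K : eqType) (x y : option K).

(** An automaton whose states are the chain: [a1] after the letter [x], [a0] after any other letter,
    [a2] once [y] has followed [x]. The letter [y] tolerates only states up to [a0], other letters
    those up to [a1]. Such threshold maps are endomorphisms, so [End L] detects adjacent pairs. *)
Definition out (o : option K) := if o == x then a1 else a0.
Definition inp (o : option K) := if o == y then a0 else a1.

Let outle o : le (out o) a2. Proof. by rewrite /out; case: ifP. Qed.

Definition letter (k : K) : endo L :=
  endo_of (threshold_is_endo (inp (Some k)) (outle (Some k))).

Definition step (b : sl_car L) (k : K) := if le b (inp (Some k)) then out (Some k) else a2.

Lemma out_le_inp o o' : le (out o) (inp o') = ~~ ((o == x) && (o' == y)).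
Proof.
rewrite /out /inp; case: eqP; case: eqP => _ _ /=; rewrite ?sl_le_refl ?le01 //.
exact: negbTE.
Qed.

Lemma run_dead s : foldl step a2 s = a2.
Proof.
elim: s => //= k s IH; rewrite /step (_ : le a2 _ = false) //.
by rewrite /inp; case: ifP => _; apply: negbTE.
Qed.

Lemma run_infix o s :
  le (foldl step (out o) s) (inp None) = ~~ infix [:: x; y] (o :: rcons (map Some s) None).
Proof.
elim: s o => [|k s IH] o.
  by rewrite /= out_le_inp !andbF !orbF andbT (eq_sym x) (eq_sym y).
rewrite [foldl _ _ _]/= /step out_le_inp.
rewrite [infix _ _]/= eq_sym (eq_sym y).
case: ifP => [/negbTE H|/negbFE H]; first by rewrite IH prefix0s andbT H.
rewrite prefix0s andbT H run_dead /inp.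
by case: ifP => _; apply: negbTE.
Qed.

Variable psi : nat -> seq K.

Definition psi_endo (n : nat) : endo L := foldr (fun k f => endo_mul (letter k) f) (endo_id L) (psi n).

Lemma psi_endoE n b : val (psi_endo n) b = foldl step b (psi n).
Proof.
rewrite /psi_endo; elim: (psi n) b => [|k s IH] b; first by rewrite /= ffunE.
by rewrite /= ffunE -IH /= ffunE.
Qed.

Lemma act_psi b u : act psi_endo b u = foldl step b (flatten (map psi u)).
Proof. by elim: u b => //= n u IH b; rewrite foldl_cat IH psi_endoE. Qed.

End Machine.

Lemma End_follows (e : identity) q : holds (End_ai L) e -> q \in words e.2 ->
  follows (words e.1) q.
Proof.
move=> H Hq K psi x y Hinf; apply/hasP; apply: contraLR Hinf => /hasPn Hno.
rewrite /ends -run_infix -act_psi; apply: endo_holds_le H Hq _ => u /Hno.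
by rewrite act_psi run_infix.
Qed.

End Follows.

(** Erase all variables but [x]: a letter next to the left marker remains exactly in the words that
    contain [x]. *)
Lemma follows_mem U q x : follows U q -> x \in q -> exists2 u, u \in U & x \in u.
Proof.
move=> H xq; pose psi n := if n == x then [:: tt] else [::].
have psiE u : flatten (map psi u) = nseq (count_mem x u) tt.
  by elim: u => //= n u ->; rewrite /psi; case: eqP.
have xq0 : 0 < count_mem x q by rewrite -has_count has_pred1.
have [|u uU] := H unit psi None (Some tt).
  by rewrite psiE /ends; case: (count_mem x q) xq0 => //= n _; rewrite prefix0s.
rewrite psiE => Hu; exists u => //; move: Hu; rewrite -has_pred1 has_count.
by case: (count_mem x u).
Qed.

Lemma infix2P (T : eqType) (d x y : T) s :
  reflect (exists t, [/\ t.+1 < size s, nth d s t = x & nth d s t.+1 = y]) (infix [:: x; y] s).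
Proof.
apply: (iffP (@infixP T [:: x; y] s)) => [[p [r ->]]|[t [Ht <- <-]]].
  exists (size p); split; first by rewrite size_cat /= !addnS !ltnS leq_addr.
    by rewrite nth_cat ltnn subnn.
  by rewrite nth_cat ltnNge leqnSn /= subSn // subnn.
exists (take t s), (drop t.+2 s); rewrite -[LHS](cat_take_drop t); congr (_ ++ _).
by rewrite (drop_nth d (ltnW Ht)) (drop_nth d Ht).
Qed.

Lemma size_ends (K : Type) (s : seq K) : size (ends s) = (size s).+2.
Proof. by rewrite /ends /= size_rcons size_map. Qed.

Lemma nth_ends (K : Type) d (s : seq K) t : t < size s -> nth None (ends s) t.+1 = Some (nth d s t).
Proof. by move=> Ht; rewrite /ends /= nth_rcons size_map Ht (nth_map d). Qed.

Lemma nth_ends_last (K : Type) (s : seq K) : nth None (ends s) (size s).+1 = None.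
Proof. by rewrite /ends /= nth_rcons size_map ltnn eqxx. Qed.

Section SparseFlatten.
Variables (K : eqType) (h : nat -> seq K).
Hypothesis h1 : forall m, size (h m) <= 1.

Lemma prefix_flatten_iota y a n :
  reflect (exists2 m, a <= m < a + n & h m = [:: y] /\ forall i, a <= i < m -> h i = [::])
          (prefix [:: y] (flatten (map h (iota a n)))).
Proof.
elim: n a => [|n IH] a /=.
  by apply: ReflectF => -[m]; rewrite addn0 ltnNge andbN.
case ha : (h a) (h1 a) => [|z [|]] // _ /=.
  apply: (iffP (IH _)) => -[m Hm [hm H]]; exists m.
  - by rewrite -addSnnS (ltnW _) //; case/andP: Hm.
  - split=> // i; rewrite leq_eqVlt => /andP[/orP[/eqP<-//|ai] im]; apply: H; exact/andP.
  - rewrite addSnnS; case/andP: Hm => + ->; rewrite leq_eqVlt andbT.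
    by case/orP => // /eqP E; rewrite -E ha in hm.
  - by split=> // i /andP[ai im]; apply: H; rewrite (ltnW ai).
rewrite prefix0s andbT; apply: (iffP eqP) => [->|[m Hm [hm H]]].
  exists a; first by rewrite leqnn addnS ltnS leq_addr.
  by split=> // i /andP[ai]; rewrite ltnNge ai.
case/andP: Hm; rewrite leq_eqVlt => /orP[/eqP E _|am _]; first by move: hm; rewrite -E ha => -[].
by move: (H a); rewrite leqnn am ha => /(_ isT).
Qed.

Lemma infix_flatten_iota x y a n :
  reflect (exists m1 m2, [/\ a <= m1, m1 < m2, m2 < a + n, h m1 = [:: x] &
             h m2 = [:: y] /\ forall i, m1 < i < m2 -> h i = [::]])
          (infix [:: x; y] (flatten (map h (iota a n)))).
Proof.
elim: n a => [|n IH] a /=.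
  by apply: ReflectF => -[m1 [m2 [am1 m12]]]; rewrite addn0 ltnNge (leq_trans am1) // ltnW.
case ha : (h a) (h1 a) => [|z [|]] // _ /=.
  apply: (iffP (IH _)) => -[m1 [m2 [am1 m12 m2a hm1 H]]]; exists m1, m2; split=> //.
  - exact: ltnW.
  - by rewrite addnS -addSn.
  - move: am1; rewrite leq_eqVlt => /orP[/eqP E|//]; by rewrite -E ha in hm1.
  - by rewrite addSn -addnS.
apply: (iffP orP) => [[/andP[/eqP-> /prefix_flatten_iota[m Hm [hm H]]]|/IH]|].
- by exists a, m; move: Hm; rewrite addSn -addnS => /andP[-> ->].
- case=> m1 [m2 [am1 m12 m2a hm1 H]]; exists m1, m2; split=> //; first exact: ltnW.
  by rewrite addnS -addSn.
case=> m1 [m2 [am1 m12 m2a hm1 [hm2 H]]].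
move: am1; rewrite leq_eqVlt => /orP[/eqP E|am1]; [left|right].
  rewrite -E ha in hm1; case: hm1 => ->; rewrite eqxx; apply/prefix_flatten_iota.
  by exists m2; [rewrite {1}E m12 addSn -addnS | split=> // i; rewrite E; apply: H].
by apply/IH; exists m1, m2; split=> //; rewrite addSn -addnS.
Qed.

End SparseFlatten.

(** * The ruler word and its factors as isoterms *)

Section RulerWord.
Variable k : nat.
Let R := k.+2.

Definition entry (p : nat * nat) (j : nat) := if odd j then p.2 else p.1.

Fixpoint ruler_fuel (f n : nat) : nat * nat :=
  (n %% R, if f is f'.+1 then entry (ruler_fuel f' (n %/ R)) (n %% R) else 0).

Definition ruler n := ruler_fuel n n.

Lemma ruler_fuelE f n : n <= f -> ruler_fuel f n = ruler n.
Proof.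
rewrite /ruler; elim/ltn_ind: n f => -[|n] IH [|f] //= Hf.
  by rewrite mod0n div0n; case: f {Hf IH} => [|f]; rewrite /entry /= mod0n.
have lt_div : n.+1 %/ R <= n by rewrite -ltnS ltn_Pdiv.
by rewrite !(IH (n.+1 %/ R)) // (leq_trans lt_div).
Qed.

(* Block [b] of length [R] spells the letter [ruler b]: even columns carry its first coordinate and odd columns its second one, so two consecutive columns determine it. *)
Lemma rulerE n : ruler n = (n %% R, entry (ruler (n %/ R)) (n %% R)).
Proof.
rewrite -(@ruler_fuelE n.+1 n) //= ruler_fuelE //.
by case: n => // n; rewrite leqW // -ltnS ltn_Pdiv.
Qed.

Lemma ruler1 n : (ruler n).1 = n %% R. Proof. by rewrite rulerE. Qed.
Lemma ruler2 n : (ruler n).2 = entry (ruler (n %/ R)) (n %% R). Proof. by rewrite rulerE. Qed.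

Lemma block_shift m i : m %% R + i < R -> (m + i) %% R = m %% R + i /\ (m + i) %/ R = m %/ R.
Proof.
move=> H; have -> : m + i = m %/ R * R + (m %% R + i) by rewrite addnA -divn_eq.
by rewrite modnMDl divnMDl // (modn_small H) (divn_small H) addn0.
Qed.

Section Column.
Variable c : nat.
Hypothesis ck : c < k.+1.

Definition parent (a b : nat * nat) := if odd c then (b.2, a.2) else (a.2, b.2).

(** The bound on [c] keeps column [c.+1] in the same block, so the two entries are the two
    coordinates of one letter, in an order given by the parity of [c]. *)
Lemma parent_ruler m : m %% R = c -> parent (ruler m) (ruler m.+1) = ruler (m %/ R).
Proof.
move=> mc; have [] := @block_shift m 1; first by rewrite mc addn1.
rewrite addn1 mc addn1 => E1 E2; rewrite /parent !ruler2 E1 E2 mc /entry /=.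
by case: (odd c) => /=; case: (ruler _).
Qed.

Lemma entry_parent a b : entry (parent a b) c = a.2.
Proof. by rewrite /entry /parent; case: (odd c). Qed.

Section Scan.
Variables (K : eqType) (g : nat * nat -> nat * nat -> seq K).
Hypothesis gc : forall a b b', a.1 != c -> g a b = g a b'.

(** A transducer that looks one letter ahead, and by [gc] only in column [c]. The last letter serves
    as its own lookahead; this default is harmless when it is not in column [c]. As no value of a
    variable ends in column [c], scanning commutes with substitution. *)
Fixpoint scan (s : seq (nat * nat)) : seq K :=
  if s is a :: s' then g a (head a s') ++ scan s' else [::].

Lemma scan_cat s1 s2 : (s1 != [::] -> (last (0, 0) s1).1 != c) ->
  scan (s1 ++ s2) = scan s1 ++ scan s2.
Proof.
elim: s1 => //= a [|b s1] IH Hl; last by rewrite IH ?catA.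
by rewrite cats0 (@gc a (head a s2) a) // Hl.
Qed.

Lemma scan_nth s : (s != [::] -> (last (0, 0) s).1 != c) ->
  scan s = flatten [seq g (nth (0, 0) s t) (nth (0, 0) s t.+1) | t <- iota 0 (size s)].
Proof.
elim: s => //= a s IH Hl; congr (_ ++ _).
  by case: s Hl {IH} => //= /(_ isT) Hl; apply: gc.
rewrite IH; last by case: s Hl {IH}.
by rewrite (iotaDl 1 0 (size s)) -map_comp.
Qed.

Variables (phi : nat -> seq (nat * nat)).
Hypothesis phic : forall x, x < k -> phi x != [::] -> (last (0, 0) (phi x)).1 != c.

Lemma last_flatten u : (forall x, x \in u -> x < k) ->
  flatten (map phi u) != [::] -> (last (0, 0) (flatten (map phi u))).1 != c.
Proof.
elim/last_ind: u => // u x IH Hu.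
rewrite map_rcons flatten_rcons; case E : (phi x) => [|a s].
  by rewrite cats0; apply: IH => y Hy; apply: Hu; rewrite mem_rcons inE Hy orbT.
move=> _; rewrite last_cat /= -[last a s]/(last (0, 0) (a :: s)) -E; apply: phic; last by rewrite E.
by apply: Hu; rewrite mem_rcons mem_head.
Qed.

Lemma scan_flatten u : (forall x, x \in u -> x < k) ->
  scan (flatten (map phi u)) = flatten (map (scan \o phi) u).
Proof.
elim: u => //= x u IH Hu; rewrite scan_cat; last by apply: phic; apply: Hu; rewrite mem_head.
by rewrite IH // => y Hy; apply: Hu; rewrite inE Hy orbT.
Qed.

End Scan.

(* [blocks m] counts the positions below [m] that lie in column [c]. *)
Definition blocks m := (m + (k.+1 - c)) %/ R.

Lemma blocksS m : blocks m.+1 = blocks m + (m %% R == c).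
Proof.
have div1 x : R <= x < R + R -> x %/ R = 1.
  by move=> Hx; rewrite -(@subnKC R x) ?divnDl ?divnn ?divn_small //=; lia.
have E i : m + i = m %/ R * R + (m %% R + i) by rewrite addnA -divn_eq.
rewrite /blocks -[m.+1]addn1 -addnA !E !divnMDl // -addnA; congr (_ + _).
have := ltn_pmod m (isT : 0 < R); move: (m %% R) => p; rewrite /R => pR.
case: (ltngtP p c) => [pc|cp|->].
- by rewrite !divn_small //; lia.
- by rewrite !div1 /R //; lia.
- by rewrite div1 ?divn_small /R //; lia.
Qed.

Lemma blocksE m : m %% R = c -> m %/ R = blocks m.
Proof.
move=> mc; rewrite /blocks.
have -> : m + (k.+1 - c) = m %/ R * R + (m %% R + (k.+1 - c)) by rewrite addnA -divn_eq.
by rewrite divnMDl // mc subnKC ?(ltnW ck) // [_.+1 %/ _]divn_small // addn0.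
Qed.

Lemma blocks_le m n : m <= n -> blocks m <= blocks n.
Proof. by move=> mn; apply: leq_div2r; rewrite leq_add2r. Qed.

Lemma blocksD m : blocks (m + R) = (blocks m).+1.
Proof. by rewrite /blocks addnAC divnDr // divnn addn1. Qed.

Lemma block_indices P n :
  [seq m %/ R | m <- iota P n & m %% R == c] = iota (blocks P) (blocks (P + n) - blocks P).
Proof.
elim: n => [|n IH]; first by rewrite addn0 subnn.
rewrite -addn1 iotaD filter_cat map_cat IH /= addnA addn1 blocksS.
case: eqP => [/blocksE E|_] /=; last by rewrite cats0 addn0.
by rewrite E addn1 subSn ?blocks_le ?leq_addr // -addn1 iotaD /= subnKC ?blocks_le ?leq_addr.
Qed.

Lemma size_block_indices P n : count (fun t => (P + t) %% R == c) (iota 0 n) = blocks (P + n) - blocks P.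
Proof.
rewrite -(size_iota (blocks P) (_ - _)) -block_indices size_map size_filter.
by rewrite -[in RHS](addn0 P) iotaDl count_map.
Qed.

End Column.

Definition ruler_factor P n := map ruler (iota P n).

Section Isoterm.
Variables (U : seq (seq nat)) (q : seq nat).
Hypotheses (U0 : exists u, u \in U).
Hypotheses (Uk : forall u x, u \in U -> x \in u -> x < k) (qk : forall x, x \in q -> x < k).
Hypothesis Uq : follows U q.

Lemma nth_ruler_factor P n t : t < n -> nth (0, 0) (ruler_factor P n) t = ruler (P + t).
Proof. by move=> tn; rewrite (nth_map 0) ?size_iota // nth_iota. Qed.

(** Each of the [k] variables rules out one column, and [k.+1] columns have their right neighbour in
    the same block. This fixes the block length [k.+2]. *)
Lemma avoid_column (phi : nat -> seq (nat * nat)) :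
  exists2 c, c < k.+1 & forall x, x < k -> phi x != [::] -> (last (0, 0) (phi x)).1 != c.
Proof.
pose bad := [seq (last (0, 0) (phi x)).1 | x <- iota 0 k].
have [/allP Hall|/allPn[c]] := boolP (all (mem bad) (iota 0 k.+1)).
  have := uniq_leq_size (iota_uniq 0 k.+1) Hall.
  by rewrite size_map !size_iota ltnn.
rewrite mem_iota add0n /= => ck Hc; exists c => // x xk _.
apply: contraNneq Hc => <-; apply: map_f; by rewrite mem_iota.
Qed.

Section Step.
Variables (n P : nat) (phi : nat -> seq (nat * nat)).
Hypothesis HU : forall u, u \in U -> flatten (map phi u) = ruler_factor P n.
Local Notation s := (flatten (map phi q)).
Local Notation w := (ruler_factor P n).

Let adj_s x y : infix [:: x; y] (ends s) -> infix [:: x; y] (ends w).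
Proof. by case/Uq => u Hu; rewrite HU. Qed.

Let size_w : size w = n. Proof. by rewrite size_map size_iota. Qed.

Lemma isoterm0 : n = 0 -> s = w.
Proof.
move=> n0; move: adj_s; rewrite n0; case: s => // a s' /(_ None (Some a)).
by rewrite /= prefix0s eqxx => /(_ isT).
Qed.

(** This length needs its own argument: a single letter in column [c] has a parent word of length 1,
    so passing to parents need not shorten it. *)
Lemma isoterm1 : n = 1 -> s = w.
Proof.
move=> n1; move: adj_s; rewrite n1 /ruler_factor /=; case: s => [|a s'] adjs.
  by have := adjs None None isT; rewrite /= ?andbF.
have := adjs None (Some a); rewrite /= !prefix0s !eqxx /= => /(_ isT).
case/orP => // /andP[/eqP[Ea] _]; rewrite {}Ea in adjs *.
case: s' adjs => // b s' /(_ (Some (ruler P)) (Some b)).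
by rewrite /= prefix0s !eqxx /= => /(_ isT).
Qed.

(** The letter of [s] next to the left marker is also the first letter of [w]. Every later pair of
    neighbours in [s] occurs in [w], where the column advances by one. *)
Lemma col_s t : t < size s -> (nth (0, 0) s t).1 = (P + t) %% R.
Proof.
elim: t => [|t IH] Ht.
  have /adj_s/(infix2P None)[t []] : infix [:: None; Some (nth (0, 0) s 0)] (ends s).
    by apply/(infix2P None); exists 0; rewrite size_ends -(nth_ends (0,0)).
  rewrite size_ends size_w !ltnS; case: t => [|t] tn.
    case: (posnP n) => [n0|n0]; last first.
      by rewrite (nth_ends (0, 0)) ?size_w // nth_ruler_factor // => _ [<-]; rewrite ruler1.
    by move: (nth_ends_last w); rewrite size_w n0 => ->.
  by rewrite (nth_ends (0, 0)) // size_w.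
have /adj_s/(infix2P None)[i []] : infix [:: Some (nth (0, 0) s t); Some (nth (0, 0) s t.+1)] (ends s).
  apply/(infix2P None); exists t.+1; rewrite size_ends !ltnS (ltnW Ht).
  by rewrite !(nth_ends (0, 0)) // ltnW.
rewrite size_ends size_w !ltnS; case: i => [|i] // ni.
rewrite (nth_ends (0, 0)) ?size_w //.
have [ni'|ni'] := ltnP i.+1 n; last first.
  have -> : i.+2 = (size w).+1 by rewrite size_w; lia.
  by rewrite nth_ends_last.
rewrite (nth_ends (0, 0)) ?size_w // !nth_ruler_factor // => -[E1] [E2].
have Eit : (P + i) %% R = (P + t) %% R by rewrite -ruler1 E1 IH // ltnW.
by rewrite -E2 ruler1 !addnS -[(P + i).+1]addn1 -[(P + t).+1]addn1 -modnDml Eit modnDml.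
Qed.

Lemma last_col_s : 0 < n -> 0 < size s /\ (size s = n %[mod R]).
Proof.
move=> n0; have s0 : 0 < size s.
  rewrite lt0n; apply/negP => /eqP/size0nil s0.
  have /adj_s/(infix2P None)[t []] : infix [:: None; None] (ends s) by rewrite s0.
  rewrite size_ends size_w !ltnS; case: t => [|t] tn.
    by rewrite (nth_ends (0, 0)) ?size_w.
  by rewrite (nth_ends (0, 0)) ?size_w.
split=> //.
have /adj_s/(infix2P None)[t []] : infix [:: Some (nth (0, 0) s (size s).-1); None] (ends s).
  apply/(infix2P None); exists (size s); rewrite size_ends nth_ends_last.
  by split=> //; rewrite -[in LHS](prednK s0) (nth_ends (0, 0)) ?prednK.
rewrite size_ends size_w !ltnS; case: t => [|t] tn //.
rewrite (nth_ends (0, 0)) ?size_w // nth_ruler_factor // => -[E].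
have [tn'|tn'] := ltnP t.+1 n; first by rewrite (nth_ends (0, 0)) ?size_w.
move=> _; have := col_s (t := (size s).-1); rewrite prednK // leqnn => /(_ isT).
rewrite -E ruler1 => /eqP; rewrite eqn_modDl -(eqn_modDr 1) !addn1 prednK // => /eqP <-.
by congr (_ %% _); apply/eqP; rewrite eqn_leq tn.
Qed.

Variable c : nat.
Hypotheses (ck : c < k.+1)
  (phic : forall x, x < k -> phi x != [::] -> (last (0, 0) (phi x)).1 != c).

Definition parents (a b : nat * nat) : seq (nat * nat) := if a.1 == c then [:: parent c a b] else [::].

Lemma parents_w m : parents (ruler m) (ruler m.+1) = if m %% R == c then [:: ruler (m %/ R)] else [::].
Proof. by rewrite /parents ruler1; case: eqP => // /(parent_ruler ck) ->. Qed.

Lemma parents_c a b b' : a.1 != c -> parents a b = parents a b'.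
Proof. by rewrite /parents => /negbTE->. Qed.

Lemma last_w : w != [::] -> (last (0, 0) w).1 != c.
Proof. have [u Hu] := U0; rewrite -(HU Hu); apply: last_flatten => // x; exact: Uk. Qed.

Lemma scan_w (K : eqType) (g : nat * nat -> nat * nat -> seq K) :
  (forall a b b', a.1 != c -> g a b = g a b') ->
  scan g w = flatten [seq g (ruler (P + t)) (ruler (P + t).+1) | t <- iota 0 n].
Proof.
move=> gc; rewrite (scan_nth gc) ?size_w; last exact: last_w.
congr flatten; apply/eq_in_map => t; rewrite mem_iota add0n /= => tn.
rewrite nth_ruler_factor //.
have [tn'|tn'] := ltnP t.+1 n; first by rewrite nth_ruler_factor // addnS.
apply: gc; rewrite -(nth_ruler_factor P tn).
have -> : t = (size w).-1 by rewrite size_w; lia.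
rewrite nth_last; apply: last_w; rewrite -size_eq0 size_w.
by case: (n) tn.
Qed.

(** Self-similarity: the parents of a factor form a factor again, to which the induction hypothesis
    applies. *)
Lemma scan_parents_w : scan parents w = ruler_factor (blocks c P) (blocks c (P + n) - blocks c P).
Proof.
rewrite scan_w; last exact: parents_c.
rewrite /ruler_factor -(block_indices ck) -map_comp -[in RHS](addn0 P) iotaDl filter_map -map_comp.
elim: (iota 0 n) => //= t l ->; rewrite parents_w; by case: ifP.
Qed.

Lemma few_blocks : 1 < n -> blocks c (P + n) - blocks c P < n.
Proof.
move=> n1; rewrite -(size_block_indices ck) ltn_neqAle.
have := count_size (fun t => (P + t) %% R == c) (iota 0 n); rewrite size_iota => ->; rewrite andbT.
apply/negP; rewrite -{2}(size_iota 0 n) -all_count => /allP H.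
have := H 0; rewrite mem_iota /= addn0 (ltnW n1) => /(_ isT)/eqP E0.
have := H 1; rewrite mem_iota /= n1 => /(_ isT)/eqP.
have [] := @block_shift P 1; first by rewrite E0 addn1.
by move=> -> _; rewrite E0; lia.
Qed.

Hypothesis n_gt0 : 0 < n.
Hypothesis sub_eq : flatten (map (scan parents \o phi) q) = scan parents w.

Let sub_eq' : scan parents s = scan parents w.
Proof. by rewrite (scan_flatten parents_c phic). Qed.

Let last_s : s != [::] -> (last (0, 0) s).1 != c.
Proof. exact: last_flatten. Qed.

Let scan_s (K : eqType) (g : nat * nat -> nat * nat -> seq K) :
  (forall a b b', a.1 != c -> g a b = g a b') ->
  scan g s = flatten [seq g (nth (0, 0) s t) (nth (0, 0) s t.+1) | t <- iota 0 (size s)].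
Proof. by move=> gc; rewrite (scan_nth gc). Qed.

Lemma flatten_if (T : Type) (p : pred nat) (f : nat -> T) l :
  flatten [seq if p t then [:: f t] else [::] | t <- l] = [seq f t | t <- l & p t].
Proof. by elim: l => //= t l ->; case: ifP. Qed.

Let scan_parents_s :
  scan parents s = [seq parent c (nth (0, 0) s t) (nth (0, 0) s t.+1) | t <- iota 0 (size s) & (P + t) %% R == c].
Proof.
rewrite scan_s; last exact: parents_c.
rewrite -flatten_if; congr flatten; apply/eq_in_map => t.
by rewrite mem_iota add0n /= /parents => ts; rewrite col_s.
Qed.

(** Equal parent words mean that [s] and [w] meet column [c] equally often. Their lengths are
    congruent modulo [R]; if they were different, the longer word would contain at least one more
    full period, hence one more letter in column [c]. *)
Lemma size_s : size s = n.
Proof.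
have [s0 smod] := last_col_s n_gt0.
have Eb : blocks c (P + size s) = blocks c (P + n).
  have := congr1 size sub_eq'; rewrite scan_parents_s size_map size_filter (size_block_indices ck).
  rewrite scan_parents_w size_map size_iota => E.
  by rewrite -(subnK (blocks_le c (leq_addr (size s) P))) E subnK // blocks_le ?leq_addr.
have key i j : i < j -> i = j %[mod R] -> blocks c (P + i) < blocks c (P + j).
  move=> ij /eqP; rewrite eq_sym eqn_mod_dvd; last exact: ltnW.
  move=> /dvdn_leq; rewrite subn_gt0 => /(_ ij) Hij.
  rewrite -blocksD -addnA; apply: blocks_le; rewrite leq_add2l.
  by rewrite -(subnKC (ltnW ij)) leq_add2l.
case: (ltngtP (size s) n) => // H.
  by have := key _ _ H smod; rewrite Eb ltnn.
by have := key _ _ H (esym smod); rewrite Eb ltnn.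
Qed.

Let parent_s t : t < n -> (P + t) %% R = c ->
  parent c (nth (0, 0) s t) (nth (0, 0) s t.+1) = ruler ((P + t) %/ R).
Proof.
move=> tn tc; have := sub_eq'; rewrite scan_parents_s size_s scan_w; last exact: parents_c.
rewrite (eq_map (fun t => parents_w (P + t))) flatten_if => /eq_in_map; apply.
by rewrite mem_filter mem_iota tc eqxx.
Qed.

Section OtherColumn.
Variable j : nat.
Hypothesis jc : j != c.

(** Only columns [c] and [j] are kept, and column [c] is replaced with the letter spelled by its
    block. An entry of column [j] next to the letter [p] of its own block can only be [entry p j],
    so adjacency determines it. *)
Definition column (a b : nat * nat) : seq ((nat * nat) + nat) :=
  if a.1 == c then [:: inl (parent c a b)] else if a.1 == j then [:: inr a.2] else [::].

Lemma column_c a b b' : a.1 != c -> column a b = column a b'.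
Proof. by rewrite /column => /negbTE->. Qed.

(** The scanned word with its end markers, cut into pieces of length at most one and indexed by
    positions, so that adjacency becomes a statement on positions with nothing in between. Position
    [t] of the word has index [t.+1]. *)
Definition marked (S : nat -> nat * nat) (i : nat) : seq (option ((nat * nat) + nat)) :=
  if (i == 0) || (i == n.+1) then [:: None] else map Some (column (S i.-1) (S i)).

Lemma marked1 S i : size (marked S i) <= 1.
Proof. by rewrite /marked /column; do 3![case: ifP => //]. Qed.

Lemma ends_marked S (l : seq ((nat * nat) + nat)) :
  l = flatten [seq column (S t) (S t.+1) | t <- iota 0 n] ->
  ends l = flatten (map (marked S) (iota 0 n.+2)).
Proof.
move=> ->; rewrite /ends -[n.+2]addn1 iotaD map_cat flatten_cat /= -cats1; congr (_ :: _ ++ _); last first.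
  by rewrite /marked add0n eqxx orbT.
rewrite (iotaDl 1 0 n) -map_comp map_flatten -map_comp; congr flatten.
apply/eq_in_map => t; rewrite mem_iota add0n /= => tn.
by rewrite /marked /= add1n eqSS (ltn_eqF tn).
Qed.

Let S t := nth (0, 0) s t.
Let W t := ruler (P + t).

(** This is [follows] for the substitution [scan column \o phi], which erases and refines the values
    of [phi]. *)
Let marked_sub m1 m2 x y : m1 < m2 -> m2 < n.+2 -> marked S m1 = [:: x] -> marked S m2 = [:: y] ->
  (forall i, m1 < i < m2 -> marked S i = [::]) ->
  exists m1' m2', [/\ m1' < m2', m2' < n.+2, marked W m1' = [:: x], marked W m2' = [:: y] &
    forall i, m1' < i < m2' -> marked W i = [::]].
Proof.
move=> m12 m2n H1 H2 H3.
have : infix [:: x; y] (ends (scan column s)).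
  rewrite (@ends_marked S); last by rewrite -size_s; apply: scan_s; apply: column_c.
  by apply/(infix_flatten_iota (marked1 S)); exists m1, m2; rewrite add0n.
rewrite (scan_flatten column_c phic) //.
case/Uq => u Hu; rewrite -(scan_flatten column_c phic); last by move=> z; apply: Uk.
rewrite HU // (@ends_marked W); last first.
  by rewrite scan_w; [congr flatten; apply: eq_map => t; rewrite /W addnS | exact: column_c].
case/(infix_flatten_iota (marked1 W)) => i1 [i2 [_ i12]]; rewrite add0n => i2n E1 [E2 E3].
by exists i1, i2.
Qed.

Let marked_col i t : i = t.+1 -> t < n ->
  forall S', (S' t).1 = (P + t) %% R -> 
  marked S' i = if (P + t) %% R == c then [:: Some (inl (parent c (S' t) (S' t.+1)))]
                else if (P + t) %% R == j then [:: Some (inr (S' t).2)] else [::].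
Proof.
move=> -> tn S' St; rewrite /marked /= eqSS (ltn_eqF tn) /column St.
by case: ifP => // _; case: ifP.
Qed.

Let S_col t : t < n -> (S t).1 = (P + t) %% R.
Proof. by move=> tn; rewrite /S col_s // size_s. Qed.
Let W_col t : (W t).1 = (P + t) %% R.
Proof. by rewrite /W ruler1. Qed.

Let markedS t : t < n -> marked S t.+1 =
  if (P + t) %% R == c then [:: Some (inl (ruler ((P + t) %/ R)))]
  else if (P + t) %% R == j then [:: Some (inr (S t).2)] else [::].
Proof.
move=> tn; rewrite (marked_col erefl tn (S_col tn)); case: eqP => // tc.
by rewrite parent_s.
Qed.

Let markedW t : t < n -> marked W t.+1 =
  if (P + t) %% R == c then [:: Some (inl (ruler ((P + t) %/ R)))]
  else if (P + t) %% R == j then [:: Some (inr (W t).2)] else [::].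
Proof.
move=> tn; rewrite (marked_col erefl tn (W_col t)); case: eqP => // tc.
by rewrite /W addnS parent_ruler.
Qed.

Let marked0 S' : marked S' 0 = [:: None]. Proof. by []. Qed.
Let markedn S' : marked S' n.+1 = [:: None]. Proof. by rewrite /marked eqxx orbT. Qed.

Let inr_W i v : i < n.+2 -> marked W i = [:: Some (inr v)] ->
  exists2 t, i = t.+1 & [/\ t < n, (P + t) %% R = j & v = (W t).2].
Proof.
case: i => [|t]; first by rewrite marked0.
rewrite !ltnS leq_eqVlt => /orP[/eqP->|tn]; first by rewrite markedn.
rewrite markedW //; case: eqP => // _; case: eqP => // tj [<-]; by exists t.
Qed.

Let inl_W i p : i < n.+2 -> marked W i = [:: Some (inl p)] ->
  exists2 t, i = t.+1 & [/\ t < n, (P + t) %% R = c & p = ruler ((P + t) %/ R)].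
Proof.
case: i => [|t]; first by rewrite marked0.
rewrite !ltnS leq_eqVlt => /orP[/eqP->|tn]; first by rewrite markedn.
rewrite markedW //; case: eqP => [tc [<-]|_]; first by exists t.
by case: eqP.
Qed.

Let nempty_W t : t < n -> marked W t.+1 = [::] -> (P + t) %% R != c /\ (P + t) %% R != j.
Proof. by move=> tn; rewrite markedW //; case: eqP => // _; case: eqP. Qed.

Let cR : c < R. Proof. exact: ltnW. Qed.

(** After scanning, the entry is followed by the letter of its own block, or by the end marker if
    the word stops before column [c]. The same pair occurs in the scan of [w], where either
    neighbour determines the entry. *)
Lemma val_left t : j < c -> t < n -> (P + t) %% R = j -> S t = W t.
Proof.
move=> jc' tn tj; have jR := ltn_trans jc' cR.
have St : marked S t.+1 = [:: Some (inr (S t).2)] by rewrite markedS // tj (negbTE jc) eqxx.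
have shift i : i <= c - j -> (P + (t + i)) %% R = j + i /\ (P + (t + i)) %/ R = (P + t) %/ R.
  move=> Hi; rewrite addnA -tj; apply: block_shift; rewrite tj.
  by apply: leq_ltn_trans cR; rewrite -(subnKC (ltnW jc')) leq_add2l.
have empty i : 0 < i < c - j -> t + i < n -> marked S (t + i).+1 = [::].
  case/andP=> i0 ic ni; rewrite markedS //; have [-> _] := shift i (ltnW ic).
  by rewrite (ltn_eqF _) ?(gtn_eqF _) // -?[X in _ < X](subnKC (ltnW jc')) ?ltn_add2l // -[X in X < _]addn0 ltn_add2l.
suff E : (S t).2 = (W t).2 by apply/eqP; rewrite -pair_eqE /pair_eq E eqxx S_col // W_col eqxx.
have [tcn|tcn] := ltnP (t + (c - j)) n.
  have [Ec Ediv] := shift _ (leqnn _); rewrite subnKC ?(ltnW jc') // in Ec.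
  have [|||||i1 [i2 [i12 i2n E1 E2 E3]]] :=
    @marked_sub t.+1 (t + (c - j)).+1 (Some (inr (S t).2)) (Some (inl (ruler ((P + t) %/ R)))).
  - by rewrite ltnS -[X in X < _]addn0 ltn_add2l subn_gt0.
  - by rewrite !ltnS ltnW.
  - exact: St.
  - by rewrite markedS // Ec eqxx Ediv.
  - case=> // i /andP[ti ic]; rewrite !ltnS in ti ic.
    rewrite -(subnKC (ltnW ti)); apply: empty; last by rewrite subnKC ?(ltn_trans ic) // ltnW.
    by rewrite subn_gt0 ti ltn_subLR // ltnW.
  have [t1 Ei1 [t1n t1j ->]] := inr_W (ltn_trans i12 i2n) E1.
  have [t2 Ei2 [t2n t2c Ep]] := inl_W i2n E2.
  rewrite /W ruler2 t1j ruler2 tj Ep; congr (entry (ruler _) _).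
  rewrite Ei1 Ei2 ltnS in i12.
  have shift1 i : i <= c - j -> (P + (t1 + i)) %% R = j + i /\ (P + (t1 + i)) %/ R = (P + t1) %/ R.
    move=> Hi; rewrite addnA -t1j; apply: block_shift; rewrite t1j.
    by apply: leq_ltn_trans cR; rewrite -(subnKC (ltnW jc')) leq_add2l.
  (* A closer [t2] would not be in column [c]; for a farther one, column [c] of the block of [t1]
     would leave a mark in between. *)
  case: (ltngtP t2 (t1 + (c - j))) => [lt|gt|->]; last by have [_ ->] := shift1 _ (leqnn _).
  - have [] := shift1 (t2 - t1); first by rewrite leq_subLR ltnW.
    by rewrite subnKC 1?ltnW // t2c => Ecj _; lia.
  - have [] := shift1 _ (leqnn (c - j)); rewrite subnKC 1?ltnW // => E4 _.
    have := E3 (t1 + (c - j)).+1; rewrite Ei1 Ei2 !ltnS gt andbT -[X in X < _]addn0 ltn_add2l subn_gt0 jc'.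
    by move=> /(_ isT) /(nempty_W (ltn_trans gt t2n)) []; rewrite E4 eqxx.
(* The word ends before column [c] of this block. In [w] only the last position in column [j] is
   followed by the end marker, and this position is [t]. *)
have [|||||i1 [i2 [i12 i2n E1 E2 E3]]] :=
  @marked_sub t.+1 n.+1 (Some (inr (S t).2)) None.
- by rewrite ltnS.
- by [].
- exact: St.
- exact: markedn.
- case=> // i /andP[ti ic]; rewrite !ltnS in ti ic.
  rewrite -(subnKC (ltnW ti)); apply: empty; last by rewrite subnKC // ltnW.
  by rewrite subn_gt0 ti ltn_subLR ?(leq_trans ic) // ltnW.
have [t1 Ei1 [t1n t1j ->]] := inr_W (ltn_trans i12 i2n) E1.
have Ei2 : i2 = n.+1.
  case: i2 i12 i2n E2 {E3} => // t2 _; rewrite !ltnS leq_eqVlt => /orP[/eqP->//|t2n].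
  by rewrite markedW //; case: eqP => // _; case: eqP.
rewrite {}Ei1 {}Ei2 in i12 E3.
case: (ltngtP t1 t) => [lt|gt|-> //].
  have := E3 t.+1; rewrite !ltnS lt tn => /(_ isT) /(nempty_W tn) [_].
  by rewrite tj eqxx.
have : t = t1 %[mod R] by apply/eqP; rewrite -(eqn_modDl P) tj t1j.
move/eqP; rewrite eq_sym eqn_mod_dvd 1?ltnW // => /dvdn_leq; rewrite subn_gt0 => /(_ gt) HR.
by move: HR cR t1n tcn; lia.
Qed.

(** Mirror image of [val_left]: the left neighbour is the letter of the block, or the left marker if
    the factor starts after column [c] of this block. *)
Lemma val_right t : c < j -> t < n -> (P + t) %% R = j -> S t = W t.
Proof.
move=> cj tn tj; have jR : j < R by rewrite -tj ltn_pmod.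
have St : marked S t.+1 = [:: Some (inr (S t).2)] by rewrite markedS // tj (negbTE jc) eqxx.
suff E : (S t).2 = (W t).2 by apply/eqP; rewrite -pair_eqE /pair_eq E eqxx S_col // W_col eqxx.
have back i : i <= t -> i <= j -> (P + (t - i)) %% R = j - i /\ (P + (t - i)) %/ R = (P + t) %/ R.
  move=> it ij; have Ptd : P + (t - i) = (P + t) %/ R * R + (j - i).
    by rewrite !addnBA // -tj -divn_eq.
  have jiR : j - i < R by apply: leq_ltn_trans jR; apply: leq_subr.
  by rewrite Ptd modnMDl divnMDl // (modn_small jiR) (divn_small jiR) addn0.
have empty i : 0 < i < j - c -> i <= t -> marked S (t - i).+1 = [::].
  case/andP=> i0 ic it; rewrite markedS ?(leq_ltn_trans (leq_subr _ _)) //.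
  have ij : i <= j by rewrite (leq_trans (ltnW ic)) // leq_subr.
  have [-> _] := back _ it ij.
  by rewrite gtn_eqF ?ltn_eqF //; lia.
have [tcn|tcn] := leqP (j - c) t.
  have [Ec Ediv] := back _ tcn (leq_subr _ _); rewrite subKn ?(ltnW cj) // in Ec.
  have [|||||i1 [i2 [i12 i2n E1 E2 E3]]] :=
    @marked_sub (t - (j - c)).+1 t.+1 (Some (inl (ruler ((P + t) %/ R)))) (Some (inr (S t).2)).
  - by rewrite ltnS ltn_subrL subn_gt0 cj (leq_trans _ tcn) // subn_gt0.
  - by rewrite !ltnS ltnW.
  - by rewrite markedS ?(leq_ltn_trans (leq_subr _ _)) // Ec eqxx Ediv.
  - exact: St.
  - case=> // i /andP[ti ic]; rewrite !ltnS in ti ic.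
    rewrite -(subKn (ltnW ic)); apply: empty; last exact: leq_subr.
    by rewrite subn_gt0 ic /= ltn_subLR ?(ltnW ic) // addnC -ltn_subLR.
  have [t1 Ei1 [t1n t1c Ep]] := inl_W (ltn_trans i12 i2n) E1.
  have [t2 Ei2 [t2n t2j ->]] := inr_W i2n E2.
  rewrite /W ruler2 t2j ruler2 tj Ep; congr (entry (ruler _) _).
  rewrite Ei1 Ei2 ltnS in i12.
  have shift1 i : i <= j - c -> (P + (t1 + i)) %% R = c + i /\ (P + (t1 + i)) %/ R = (P + t1) %/ R.
    move=> Hi; rewrite addnA -t1c; apply: block_shift; rewrite t1c.
    by apply: leq_ltn_trans jR; rewrite -(subnKC (ltnW cj)) leq_add2l.
  case: (ltngtP t2 (t1 + (j - c))) => [lt|gt|->]; last by have [_ ->] := shift1 _ (leqnn _).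
  - have [] := shift1 (t2 - t1); first by rewrite leq_subLR ltnW.
    by rewrite subnKC 1?ltnW // t2j => Ecj _; lia.
  - have [] := shift1 _ (leqnn (j - c)); rewrite subnKC 1?ltnW // => E4 _.
    have := E3 (t1 + (j - c)).+1; rewrite Ei1 Ei2 !ltnS gt andbT -[X in X < _]addn0 ltn_add2l subn_gt0 cj.
    by move=> /(_ isT) /(nempty_W (ltn_trans gt t2n)) [_]; rewrite E4 eqxx.
have [|||||i1 [i2 [i12 i2n E1 E2 E3]]] :=
  @marked_sub 0 t.+1 None (Some (inr (S t).2)).
- by [].
- by rewrite !ltnS ltnW.
- exact: marked0.
- exact: St.
- case=> // i /andP[_ ic]; rewrite !ltnS in ic.
  rewrite -(subKn (ltnW ic)); apply: empty; last exact: leq_subr.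
  by rewrite subn_gt0 ic /= (leq_ltn_trans (leq_subr _ _)).
have [t2 Ei2 [t2n t2j ->]] := inr_W i2n E2.
have Ei1 : i1 = 0.
  case: i1 i12 E1 {E3} => // t1; rewrite Ei2 ltnS => t12.
  by rewrite markedW ?(ltn_trans t12) //; case: eqP => // _; case: eqP.
rewrite {}Ei1 {}Ei2 in i12 E3.
case: (ltngtP t t2) => [lt|gt|-> //].
  have := E3 t.+1; rewrite !ltnS lt => /(_ isT) /(nempty_W tn) [_].
  by rewrite tj eqxx.
have : t2 = t %[mod R] by apply/eqP; rewrite -(eqn_modDl P) tj t2j.
move/eqP; rewrite eq_sym eqn_mod_dvd 1?ltnW // => /dvdn_leq; rewrite subn_gt0 => /(_ gt) HR.
by move: HR jR tcn; lia.
Qed.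

End OtherColumn.

Lemma isoterm_step : s = w.
Proof.
apply: (@eq_from_nth _ (0, 0)) => [|t]; rewrite size_s ?size_w // => tn.
rewrite nth_ruler_factor //; case: (ltngtP ((P + t) %% R) c) => H.
- by apply: val_left (erefl _) => //; rewrite ltn_eqF.
- by apply: val_right (erefl _) => //; rewrite gtn_eqF.
apply/eqP; rewrite -pair_eqE /pair_eq col_s ?size_s // ruler1 eqxx ruler2 /=.
by rewrite -(parent_s tn H) H entry_parent.
Qed.

End Step.

(** The words stay fixed while [phi] and [P] vary: the induction hypothesis is used for the parents
    of the values of [phi], and each level avoids a column of its own. *)
Theorem ruler_isoterm n P phi :
  (forall u, u \in U -> flatten (map phi u) = ruler_factor P n) ->
  flatten (map phi q) = ruler_factor P n.
Proof.
elim/ltn_ind: n P phi => -[|[|n]] IH P phi HU.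
- exact: (isoterm0 HU).
- exact: (isoterm1 HU).
have [c ck phic] := avoid_column phi.
apply: (isoterm_step HU ck phic) => //.
rewrite (scan_parents_w HU ck phic).
apply: IH; first exact: few_blocks.
move=> u Hu; rewrite -(scan_parents_w HU ck phic) -(scan_flatten (@parents_c c) phic) ?HU //.
by move=> x; apply: Uk.
Qed.

End Isoterm.

End RulerWord.

Lemma cat_cancel2 (T : eqType) (l r x y : seq T) : l ++ x ++ r = l ++ y ++ r -> x = y.
Proof.
move/eqP; rewrite eqseq_cat // eqxx /= => /eqP E.
have sz : size x = size y by move/(congr1 size): E; rewrite !size_cat => /addIn.
by move/eqP: E; rewrite eqseq_cat // => /andP[/eqP].
Qed.

Lemma mprod_flatten_map (T : Type) (h : nat -> seq T) u : mprod cat [::] h u = flatten (map h u).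
Proof. by elim: u => //= x u IH; rewrite /mprod /= -/(mprod _ _ _ _) IH. Qed.

Lemma ruler_factor_middle k l x r m : l ++ x ++ r = ruler_factor k 0 m ->
  x = ruler_factor k (size l) (m - size l - size r).
Proof.
move=> E; have sz : m = size l + (size x + size r).
  by move/(congr1 size): E; rewrite !size_cat size_map size_iota.
have -> : x = take (size x) (drop (size l) (ruler_factor k 0 m)).
  by rewrite -E drop_size_cat // take_size_cat.
rewrite /ruler_factor -map_drop drop_iota add0n -map_take take_iota.
by congr (map _ (iota _ _)); lia.
Qed.

(** * An infinite finitely generated semiring from the ruler word *)

Section RulerSemiring.
Variable k : nat.
Let R := k.+2.

Definition ruler_letter n : seq (nat * nat) := [:: (n %/ R, n %% R)].
Definition ruler_target (i : seq (nat * nat)) : Prop := exists m, i = ruler_factor k 0 m.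
(** One language for each prefix: all words put into it by a context spell the same word, so
    cancellation applies. *)
Definition ruler_language i w := ruler_target i /\ mprod cat [::] ruler_letter w = i.
Definition ruler_semiring : aiSemiring := syn ruler_language.

Lemma ruler_lt n : (ruler k n).1 < R /\ (ruler k n).2 < R.
Proof.
elim/ltn_ind: n => n IH; rewrite ruler1 ruler2 ltn_pmod //; split=> //.
have [lt|ge] := ltnP (n %/ R) n; first by rewrite /entry; case: ifP; case: (IH _ lt).
have -> : n = 0 by case: n ge {IH} => // n; rewrite leqNgt ltn_Pdiv.
by rewrite div0n mod0n.
Qed.

Definition ruler_code n := (ruler k n).1 * R + (ruler k n).2.

Lemma ruler_letter_code n : ruler_letter (ruler_code n) = [:: ruler k n].
Proof.
rewrite /ruler_letter /ruler_code; have [_ H] := ruler_lt n.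
by rewrite divnMDl // modnMDl (divn_small H) (modn_small H) addn0; case: (ruler k n).
Qed.

Lemma ruler_word_code m : mprod cat [::] ruler_letter (map ruler_code (iota 0 m)) = ruler_factor k 0 m.
Proof.
rewrite mprod_flatten_map -map_comp /ruler_factor -(flatten_map1 (ruler k)).
by congr flatten; apply: eq_map => n; apply: ruler_letter_code.
Qed.

(** Letters from [R * R] on decode to pairs outside the ruler word. No context puts them into a
    language, so they are all equal to the letter [R * R]. *)
Lemma ruler_semiring_fg : finitely_generated ruler_semiring.
Proof.
pose g n : ai_car ruler_semiring := syn_of ruler_language (tVar n).
exists (map g (iota 0 (R * R).+1)) => x; exists (syn_rep x), g; split=> [n|]; last first.
  rewrite -[RHS]syn_repK eval_syn; congr (syn_of _ _).
  by elim: (syn_rep x) => //= p -> q ->.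
rewrite (_ : g n = g (minn n (R * R))).
  by apply: in_map_seq; apply/in_inE; rewrite mem_iota /= add0n ltnS geq_minr.
have [lt|ge] := ltnP n (R * R); first by [].
have big m l r i : R * R <= m -> ~ ruler_language i (l ++ [:: m] ++ r).
  move=> Hm [[j ->]]; rewrite mprod_flatten_map !map_cat !flatten_cat.
  move=> /(congr1 (fun s => (m %/ R, m %% R) \in s)).
  rewrite !mem_cat /= mem_head orbT => /esym/mapP[a _ E].
  have [] := ruler_lt a; rewrite -E /=; rewrite ltn_divLR // => H _.
  by move: H; rewrite ltnNge Hm.
apply: syn_ofP => i l r /=; split=> H w; rewrite inE => /eqP->.
  by have /big : ruler_language i (l ++ [:: n] ++ r) by apply: H; rewrite inE.
have /big : ruler_language i (l ++ [:: R * R] ++ r) by apply: H; rewrite inE.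
by move/(_ (leqnn _)).
Qed.

Lemma ruler_semiring_infinite : ~ finite_ai ruler_semiring.
Proof.
case/finite_ai_enum => n [f [g fK]].
pose t (m : 'I_n.+1) := term_of (map ruler_code (iota 0 m.+1)).
have inj : injective (fun m => g (syn_of ruler_language (t m))).
  move=> m1 m2 /(can_inj fK) E.
  have H1 w : w \in words (t m1) -> ruler_language (ruler_factor k 0 m1.+1) ([::] ++ w ++ [::]).
    rewrite /t words_term_of // inE => /eqP->; rewrite cats0 cat0s.
    by split; [exists m1.+1 | rewrite ruler_word_code].
  have H2 : map ruler_code (iota 0 m2.+1) \in words (t m2) by rewrite /t words_term_of // mem_head.
  have [_] := syn_of_inj E H1 H2; rewrite cats0 cat0s ruler_word_code.
  by move=> /(congr1 size); rewrite !size_map !size_iota => -[] /esym/val_inj.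
by have := leq_card _ inj; rewrite !card_ord ltnn.
Qed.

Lemma ruler_semiring_implies (L : finSemilattice) e : 3 <= height L -> bounded k e ->
  holds (End_ai L) e -> syn_implies ruler_language e.
Proof.
move=> /height_chain[a0 [a1 [a2 [le01 le12 ne01 ne12]]]] bk He.
have fol q : q \in words e.2 -> follows (words e.1) q by apply: End_follows le01 le12 ne01 ne12 _ _ He.
apply: syn_monoid_implies; rewrite //.
- exact: catA.
- exact: cat_cancel2.
- by move=> q x /fol/follows_mem; apply.
move=> h l r i [m ->] HU q Hq.
have HU' u : u \in words e.1 -> flatten (map h u) = ruler_factor k (size l) (m - size l - size r).
  by move=> /HU; rewrite mprod_flatten_map => /ruler_factor_middle.
have [u Hu] := words_neq0 e.1.
rewrite -(HU _ Hu) !mprod_flatten_map (HU' _ Hu); congr (_ ++ (_ ++ _)).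
apply: (@ruler_isoterm k (words e.1)) => //.
- by exists u.
- by move=> u' x Hu' Hx; apply: bk Hx; rewrite mem_cat Hu'.
- by move=> x Hx; apply: bk Hx; rewrite mem_cat Hq orbT.
- exact: fol.
Qed.

Lemma bounded_sym e : bounded k e -> bounded k (e.2, e.1).
Proof. by move=> H u x /=; rewrite mem_cat orbC -mem_cat; apply: H. Qed.

Lemma ruler_semiring_holds (L : finSemilattice) e : 3 <= height L -> bounded k e ->
  holds (End_ai L) e -> holds ruler_semiring e.
Proof.
move=> hL bk He; apply: syn_holds; apply: (ruler_semiring_implies hL) => //.
exact: bounded_sym.
Qed.

End RulerSemiring.

Theorem End_INFB (L : finSemilattice) : 3 <= height L -> inherently_nonfinitely_based (End_ai L).
Proof.
move=> hL; split=> [|Sigma lf sub]; first exact: in_var_locally_finite (End_finite L).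
have [k Hk] := identities_bounded Sigma.
apply: (@ruler_semiring_infinite k); apply: lf (ruler_semiring_fg k) => e eS.
apply: (ruler_semiring_holds hL (Hk _ eS)).
by apply: sub eS.
Qed.

(** * Linear hypergraphs in which every colouring has a monochromatic edge *)

Lemma pigeonhole_inj (T C : finType) (c : T -> C) n : #|C| * n < #|T| ->
  exists h : 'I_n -> T, injective h /\ forall i j, c (h i) = c (h j).
Proof.
move=> big; have [col Hcol] : exists col, n <= #|[pred y | c y == col]|.
  apply: NNPP => no; move: big; rewrite ltnNge => /negP; apply.
  rewrite -sum1_card (partition_big c predT) //= -sum_nat_const.
  apply: leq_sum => col _; rewrite sum1_card; apply: ltnW; rewrite ltnNge.
  by apply/negP => H; apply: no; exists col.
exists (fun i => enum_val (widen_ord Hcol i)); split=> [i j /enum_val_inj/(congr1 val)|i j].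
  by move=> /= /val_inj.
have mem l : c (enum_val (widen_ord Hcol l)) = col.
  by have := enum_valP (widen_ord Hcol l); rewrite inE => /eqP.
by rewrite !mem.
Qed.

Section Hypergraph.
Variable r : nat.

(** Distinct edges share at most one vertex, expressed by positions. *)
Definition linear_edges (V E : Type) (ed : E -> 'I_r -> V) : Prop :=
  forall e e' i i' j j', ed e i = ed e' i' -> ed e j = ed e' j' -> e <> e' -> i = j.

Section Partite.
Variables (a : nat) (C : finType).

Definition partite (V E : Type) (ed : E -> 'I_r -> V) (part : V -> 'I_a) : Prop :=
  forall e i j, part (ed e i) = part (ed e j) -> i = j.

Definition arrow (V E V' E' : Type) (ed : E -> 'I_r -> V) (part : V -> 'I_a)
    (ed' : E' -> 'I_r -> V') (part' : V' -> 'I_a) (l : seq 'I_a) : Prop :=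
  forall c : V' -> C, exists (f : V -> V') (g : E -> E'),
    [/\ forall e i, ed' (g e) i = f (ed e i), forall v, part' (f v) = part v &
        forall p v w, p \in l -> part v = p -> part w = p -> c (f v) = c (f w)].

(* Copies of the hypergraph are glued along the part [p], one for every injection of its vertices into a large set of new vertices (Nesetril-Rodl amalgamation). Two copies share vertices of one part only, and an edge has at most one vertex in it. *)
Lemma amalgamation (V E : finType) (ed : E -> 'I_r -> V) (part : V -> 'I_a) p :
  linear_edges ed -> partite ed part ->
  exists (V' E' : finType) (ed' : E' -> 'I_r -> V') (part' : V' -> 'I_a),
    [/\ linear_edges ed', partite ed' part' & arrow ed part ed' part' [:: p]].
Proof.
move=> lin par; pose Y := 'I_(#|C| * #|V|).+1.
pose J := {h : {ffun V -> Y} | injectiveb h}.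
pose emb (h : J) (v : V) : V * J + Y := if part v == p then inr (val h v) else inl (v, h).
pose ed' (e : E * J) i := emb e.2 (ed e.1 i).
pose part' (v : V * J + Y) := match v with inl v => part v.1 | inr _ => p end.
have part_emb h v : part' (emb h v) = part v by rewrite /part' /emb; case: eqP.
have emb_inj (h : J) v w : emb h v = emb h w -> v = w.
  rewrite /emb; case: eqP => _; case: eqP => _ // [] //.
  by apply: (injectiveP _ (valP h)).
exists (Finite.clone (V * J + Y)%type _), (Finite.clone (E * J)%type _), ed', part'; split.
- move=> [e h] [e' h'] i i' j j' Ei Ej ne.
  have [Eh|nh] := eqVneq h h'.
    move: ne Ei Ej; rewrite -{}Eh /ed' /= => ne /emb_inj Ei /emb_inj Ej.
    by apply: lin Ei Ej _ => E1; apply: ne; rewrite E1.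
  have in_p v w : emb h v = emb h' w -> part v = p.
    by rewrite /emb; case: eqP => // _; case: eqP => // _ [_ /eqP]; rewrite (negbTE nh).
  by apply: (par e); rewrite (in_p _ _ Ei) (in_p _ _ Ej).
- by move=> [e h] i j; rewrite !part_emb; apply: par.
move=> c; have [|h0 [h0_inj h0_mono]] := @pigeonhole_inj Y C (c \o inr) #|V|; first by rewrite card_ord.
have h_inj : injectiveb [ffun v => h0 (enum_rank v)].
  by apply/injectiveP => v w; rewrite !ffunE => /h0_inj/enum_rank_inj.
pose h : J := exist (fun h : {ffun V -> Y} => is_true (injectiveb h)) _ h_inj.
exists (emb h), (fun e => (e, h)); split=> // p' v w; rewrite inE => /eqP-> pv pw.
by rewrite /emb pv pw eqxx /= !ffunE; apply: h0_mono.
Qed.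

Lemma amalgamations (V E : finType) (ed : E -> 'I_r -> V) (part : V -> 'I_a) l :
  linear_edges ed -> partite ed part ->
  exists (V' E' : finType) (ed' : E' -> 'I_r -> V') (part' : V' -> 'I_a),
    [/\ linear_edges ed', partite ed' part' & arrow ed part ed' part' l].
Proof.
move=> lin par; elim: l => [|p l [V1 [E1 [ed1 [part1 [lin1 par1 H1]]]]]].
  by exists V, E, ed, part; split=> // c; exists id, id.
have [V2 [E2 [ed2 [part2 [lin2 par2 H2]]]]] := amalgamation p lin1 par1.
exists V2, E2, ed2, part2; split=> // c.
have [f2 [g2 [fg2 pf2 m2]]] := H2 c; have [f1 [g1 [fg1 pf1 m1]]] := H1 (c \o f2).
exists (f2 \o f1), (g2 \o g1); split=> [e i|v|p' v w].
- by rewrite /= fg2 fg1.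
- by rewrite /= pf2 pf1.
rewrite inE => /orP[/eqP->|p'l] pv pw; last exact: m1 p'l _ _.
by apply: (m2 p); rewrite ?mem_head // pf1.
Qed.

End Partite.

(** Start with disjoint edges, one for each injection of the [r] positions into [a] parts, and
    amalgamate along all parts. In a suitable copy every part has one colour; [r] parts share the
    same colour, and the edge through them is monochromatic. *)
Lemma monochromatic_edges (C : finType) :
  exists (V E : finType) (ed : E -> 'I_r -> V),
    [/\ linear_edges ed, forall e, injective (ed e) &
        forall c : V -> C, exists e, forall i j, c (ed e i) = c (ed e j)].
Proof.
(* [None] is the colour of a part without vertices. *)
pose a := (#|{: option C}| * r).+1.
pose E0 := {h : {ffun 'I_r -> 'I_a} | injectiveb h}.
pose ed0 (e : E0) (i : 'I_r) := (e, i).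
pose part0 (v : E0 * 'I_r) : 'I_a := val v.1 v.2.
have lin0 : linear_edges ed0 by move=> e e' i i' j j' [].
have par0 : partite ed0 part0 by move=> e i j; apply: (injectiveP _ (valP e)).
have [V [E [ed [part [lin par H]]]]] := amalgamations C (enum 'I_a) lin0 par0.
exists V, E, ed; split=> // [e i j E1|c]; first by apply: (par e); rewrite E1.
have [f [g [fg _ mono]]] := H c.
pose gam p := omap (c \o f) [pick v | part0 v == p].
have [|h [h_inj h_mono]] := @pigeonhole_inj _ _ gam r; first by rewrite card_ord.
have h_injb : injectiveb [ffun i => h i] by apply/injectiveP => i j; rewrite !ffunE => /h_inj.
pose e : E0 := exist (fun h : {ffun 'I_r -> 'I_a} => is_true (injectiveb h)) _ h_injb.
have gamE i : gam (h i) = Some (c (f (e, i))).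
  rewrite /gam; case: pickP => [v /eqP Hv|/(_ (e, i))] /=; last by rewrite /part0 /= ffunE eqxx.
  by congr Some; apply: (mono (h i)); rewrite ?mem_enum // /part0 /= ffunE.
exists (g e) => i j; rewrite !fg.
by have := h_mono i j; rewrite !gamE => -[].
Qed.

End Hypergraph.

(** * Semilattices of height at most two *)

Definition flat (L : finSemilattice) (top : sl_car L) : Prop :=
  forall x y : sl_car L, x != y -> sl_add x y = top.

(** If two distinct elements had a sum other than the top, one of them would lie strictly below this
    sum, which gives a chain of three elements. *)
Lemma low_height_flat (L : finSemilattice) : 0 < #|sl_car L| -> height L < 3 ->
  exists top : sl_car L, flat top.
Proof.
case/card_gt0P => x0 _ hL.
pose top := foldr (@sl_add L) x0 (enum (sl_car L)).
have le_top x : sl_le x top.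
  rewrite /top; have := mem_enum (sl_car L) x; rewrite inE.
  elim: (enum _) => //= y l IH; rewrite inE => /orP[/eqP->|/IH H].
    by rewrite /sl_le sl_addA sl_addI.
  by apply: sl_le_trans H _; rewrite /sl_le (sl_addC y) sl_addA sl_addI.
exists top => x y xy; apply/eqP; apply: contraTT hL => s_top; rewrite -leqNgt.
set s := sl_add x y in s_top.
have [z zs ze] : exists2 z, sl_le z s & z != s.
  have [Ex|] := eqVneq x s; last by exists x => //; rewrite /sl_le /s sl_addA sl_addI.
  exists y; first by rewrite /sl_le /s (sl_addC x) sl_addA sl_addI.
  by rewrite -Ex eq_sym.
have chain : sl_chain [set z; s; top].
  apply/forall_inP => u Hu; apply/forall_inP => w; rewrite !inE in Hu *.
  have zt := le_top z; have st := le_top s.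
  by case/orP: Hu => [/orP[]|] /eqP-> /orP[/orP[]|] /eqP->; rewrite ?sl_le_refl ?zs ?zt ?st ?orbT.
have zt : z != top by apply: contraNneq s_top => E; apply/eqP/sl_le_anti; rewrite // -E.
apply: leq_trans (leq_bigmax_cond _ chain).
by rewrite -setUA cardsU1 cards2 !inE negb_or ze zt s_top.
Qed.

Section Flat.
Variables (L : finSemilattice) (top : sl_car L).
Hypothesis flatL : flat top.
Local Notation A := (sl_car L).

Lemma flat_addT (x : A) : sl_add x top = top.
Proof. by have [->|/flatL//] := eqVneq x top; rewrite sl_addI. Qed.

Lemma flat_addTl (x : A) : sl_add top x = top.
Proof. by rewrite sl_addC flat_addT. Qed.

Lemma flat_le (x y : A) : sl_le x y = (x == y) || (y == top).
Proof.
rewrite /sl_le; have [->|xy] := eqVneq x y; first by rewrite sl_addI eqxx.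
by rewrite flatL // eq_sym.
Qed.

Lemma flat_le_eq (x y : A) : y != top -> sl_le x y -> x = y.
Proof. by move=> /negbTE yt; rewrite flat_le yt orbF => /eqP. Qed.

Lemma partial_injection_is_endo (f : {ffun A -> A}) : f top = top ->
  (forall x y, x != y -> f x = f y -> f x = top) -> is_endo f.
Proof.
move=> f1 finj; apply/forallP => x; apply/forallP => y.
have [->|xy] := eqVneq x y; first by rewrite !sl_addI.
rewrite flatL // f1; have [E|/flatL->//] := eqVneq (f x) (f y).
by rewrite -E sl_addI (finj _ _ xy E).
Qed.

(** If the top is moved, every value lies below a minimal element and equals it. If it is fixed, a
    common value of two distinct points is the value of their sum, the top. *)
Lemma endo_const_or_inj (f : endo L) :
  (exists2 b, b != top & forall x, val f x = b) \/
  val f top = top /\ forall x y, val f x = val f y -> val f x != top -> x = y.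
Proof.
have [f1|f1] := eqVneq (val f top) top; [right|left].
  split=> // x y E fx; apply/eqP; apply: contraNT fx => xy.
  by have := endo_hom f x y; rewrite flatL // f1 -E sl_addI => <-.
exists (val f top) => // x; apply: flat_le_eq => //.
by rewrite /sl_le -endo_hom flat_addT.
Qed.

Section Mover.
Variables al be : A.
Hypotheses (al_top : al != top) (be_top : be != top) (al_be : al != be).

Lemma mover_is_endo : is_endo [ffun x : A => if x == al then be else top].
Proof.
apply: partial_injection_is_endo => [|x y xy]; rewrite !ffunE.
  by rewrite eq_sym (negbTE al_top).
case: eqP => // Ex; case: eqP => // Ey; by rewrite Ex Ey eqxx in xy.
Qed.

Definition mover : endo L := endo_of mover_is_endo.

Lemma act_mover (nu : pred nat) u :
  act (fun n => if nu n then mover else endo_id L) al u =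
  match count nu u with 0 => al | 1 => be | _ => top end.
Proof.
elim/last_ind: u => // u n IH; rewrite /act foldl_rcons -/(act _ _ _) IH -cats1 count_cat /= addn0.
case: (nu n) => /=; last by rewrite addn0 ffunE.
rewrite addn1 ffunE; case: (count nu u) => [|[|c]]; first by rewrite eqxx.
  by rewrite eq_sym (negbTE al_be).
by rewrite eq_sym (negbTE al_top).
Qed.

End Mover.

End Flat.

(* The identities of the three-element semiring [{1, a, 0}] with [a * a = 0]. *)
Definition counting (U : seq (seq nat)) (q : seq nat) : Prop :=
  forall (nu : pred nat) (b : bool), (forall u, u \in U -> count nu u = b) -> count nu q = b.

Lemma counting_mem U q x : counting U q -> x \in q -> exists2 u, u \in U & x \in u.
Proof.
move=> Uq xq; apply/hasP; apply: contraTT xq => /hasPn no.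
rewrite -has_pred1 has_count -leqNgt leqn0; apply/eqP.
by apply: (Uq (pred1 x) false) => u /no; rewrite -has_pred1 has_count -leqNgt leqn0 => /eqP.
Qed.

Lemma End_counting (L : finSemilattice) (top al be : sl_car L) e q : flat top ->
  al != top -> be != top -> al != be ->
  holds (End_ai L) e -> q \in words e.2 -> counting (words e.1) q.
Proof.
move=> flatL al_top be_top al_be H Hq nu b HU.
have := @endo_holds_le L e (fun n => if nu n then mover flatL be al_top else endo_id L)
  al (if b then be else al) q H Hq.
rewrite !act_mover // => Hle.
have {Hle} : sl_le match count nu q with 0 => al | 1 => be | _ => top end (if b then be else al).
  by apply: Hle => u Hu; rewrite act_mover // (HU _ Hu); case: (b); apply: sl_le_refl.
move/(flat_le_eq flatL (_ : (if b then be else al) != top)); case: b {HU} => /(_ (ltac:(by []))).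
  case: (count nu q) => [|[|c]] // E; first by rewrite E eqxx in al_be.
  by rewrite -E eqxx in be_top.
case: (count nu q) => [|[|c]] // E; first by rewrite E eqxx in al_be.
by rewrite -E eqxx in al_top.
Qed.

(** * The language of the edges of a linear hypergraph *)

Lemma count1_inj (T : eqType) (p : pred T) (s : seq T) x y :
  count p s = 1 -> x \in s -> y \in s -> p x -> p y -> x = y.
Proof.
move=> c1 xs ys px py; have : size (filter p s) = 1 by rewrite size_filter.
have : x \in filter p s by rewrite mem_filter px.
have : y \in filter p s by rewrite mem_filter py.
by case: (filter p s) => [|z [|]] //; rewrite !inE => /eqP-> /eqP->.
Qed.

Lemma count_mem_flatten (T : eqType) (phi : nat -> seq T) m u : (forall x, x \in u -> uniq (phi x)) ->
  count_mem m (flatten (map phi u)) = count (fun x => m \in phi x) u.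
Proof.
elim: u => //= x u IH H; rewrite count_cat count_uniq_mem ?H ?mem_head // IH // => y Hy.
by apply: H; rewrite inE Hy orbT.
Qed.

Section EdgeLanguage.
Variables (k : nat) (Es : seq (seq nat)).
Hypothesis Euniq : forall e, e \in Es -> uniq e.
Hypothesis Esize : forall e, e \in Es -> k.+1 < size e.
Hypothesis Elinear : forall e e' m m', e \in Es -> e' \in Es -> m != m' ->
  m \in e -> m' \in e -> m \in e' -> m' \in e' -> e = e'.

Definition is_edge (w : seq nat) : Prop := exists2 e, e \in Es & perm_eq w e.

Section Local.
Variables (U : seq (seq nat)) (q : seq nat) (phi : nat -> seq nat) (c : seq nat).
Hypotheses (U0 : exists u, u \in U).
Hypotheses (Uk : forall u x, u \in U -> x \in u -> x < k) (qk : forall x, x \in q -> x < k).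
Hypothesis Uq : counting U q.
Hypothesis phi0 : forall x, phi x != [::].
Hypothesis HU : forall u, u \in U -> is_edge (c ++ flatten (map phi u)).

(** By linearity, a block of two or more letters lies in at most one edge. The ambiguous blocks are
    single letters; [Sg] collects them from the context and from the [k] variables. *)
Let single (s : seq nat) := if size s == 1 then s else [::].
Let Sg := single c ++ flatten [seq single (phi x) | x <- iota 0 k].

Let size_Sg : size Sg <= k.+1.
Proof.
have H s : size (single s) <= 1 by rewrite /single; case: eqP => // ->.
rewrite size_cat -add1n leq_add //.
rewrite size_flatten /shape -map_comp sumnE big_map.
rewrite -[X in _ <= X](size_iota 0) -sum1_size.
by apply: leq_sum => x _; apply: H.
Qed.

(** A choice of one letter in each edge that treats the letters of [Sg] alike in all edges. Whether
    a block contains the chosen letter is then independent of the edge around it, so [counting]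
    applies to the set of variables whose blocks do. *)
Let good (mk : seq nat -> nat) : Prop := (forall e, e \in Es -> mk e \in e) /\
  forall m, m \in Sg -> (forall e, e \in Es -> m \in e -> mk e = m) \/ (forall e, e \in Es -> mk e != m).

Let marked (mk : seq nat -> nat) (s : seq nat) := has (fun e => all (mem e) s && (mk e \in s)) Es.

Let block (s : seq nat) := forall m, s = [:: m] -> m \in Sg.

Let block_c : block c.
Proof. by move=> m E; rewrite /Sg {1}/single E /= mem_head. Qed.

Let block_phi x : x < k -> block (phi x).
Proof.
move=> xk m E; rewrite /Sg mem_cat; apply/orP; right; apply/flattenP.
exists (single (phi x)); first by apply: map_f; rewrite mem_iota.
by rewrite /single E mem_head.
Qed.

Let edge_unique e e' s : e \in Es -> e' \in Es -> uniq s -> 1 < size s ->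
  {subset s <= e} -> {subset s <= e'} -> e = e'.
Proof.
case: s => [|m [|m' s]] // eE e'E /= /andP[]; rewrite inE negb_or => /andP[mm' _] _ _ se se'.
by apply: (Elinear eE e'E mm'); [apply: se|apply: se|apply: se'|apply: se'];
  rewrite !inE eqxx ?orbT.
Qed.

Let markedE mk e s : good mk -> e \in Es -> uniq s -> {subset s <= e} -> block s ->
  marked mk s = (mk e \in s).
Proof.
move=> [mkE mkS] eE us se bs; apply/hasP/idP => [[e' e'E /andP[/allP se' mks]]|mks]; last first.
  by exists e => //; rewrite mks andbT; apply/allP.
case: s us se bs se' mks => [|m [|m' s]] us se bs se' mks //.
  move: mks; rewrite !inE => /eqP Em.
  case: (mkS m (bs _ erefl)) => [->|/(_ _ e'E)]; rewrite ?eqxx ?se ?mem_head //.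
  by rewrite Em eqxx.
by rewrite (edge_unique eE e'E us).
Qed.

Let sub_c u e : perm_eq (c ++ flatten (map phi u)) e -> {subset c <= e}.
Proof. by move=> /perm_mem H x xc; rewrite -H mem_cat xc. Qed.

Let sub_phi u e x : perm_eq (c ++ flatten (map phi u)) e -> x \in u -> {subset phi x <= e}.
Proof.
move=> /perm_mem H xu y yx; rewrite -H mem_cat; apply/orP; right.
by apply/flattenP; exists (phi x) => //; apply: map_f.
Qed.

Let uniq_c u : u \in U -> uniq c.
Proof. by move=> /HU[e /Euniq ue /perm_uniq]; rewrite ue cat_uniq => /andP[]. Qed.

Let uniq_phi u x : u \in U -> x \in u -> uniq (phi x).
Proof.
move=> /HU[e /Euniq ue /perm_uniq]; rewrite ue cat_uniq => /and3P[_ _].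
elim: u => //= y u IH; rewrite cat_uniq => /and3P[Hy _ /IH H].
by rewrite inE => /orP[/eqP->|/H].
Qed.

Let var_q x : x \in q -> exists2 u, u \in U & x \in u.
Proof. exact: counting_mem. Qed.

Let count_marked mk u : good mk -> u \in U -> marked mk c + count (fun x => marked mk (phi x)) u = 1.
Proof.
move=> gmk uU; have [e eE Hp] := HU uU.
have mke : mk e \in e by case: gmk => ->.
have -> : marked mk c = (mk e \in c) by apply: (markedE gmk eE (uniq_c uU)) => //; apply: sub_c Hp.
rewrite -(count_uniq_mem _ (uniq_c uU)).
have -> : count (fun x => marked mk (phi x)) u = count (fun x => mk e \in phi x) u.
  apply: eq_in_count => x xu /=; apply: (markedE gmk eE (uniq_phi uU xu)); first exact: sub_phi Hp xu.
  exact: block_phi (Uk uU xu).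
rewrite -count_mem_flatten -?count_cat; last by move=> x xu; apply: uniq_phi xu.
by rewrite (seq.permP Hp) count_uniq_mem ?mke // Euniq.
Qed.

Let star mk : good mk -> marked mk c + count (fun x => marked mk (phi x)) q = 1.
Proof.
move=> gmk; rewrite (Uq (nu := fun x => marked mk (phi x)) (b := ~~ marked mk c)).
  by case: (marked mk c).
move=> u uU; have := count_marked gmk uU; by case: (marked mk c) => /= [[]|].
Qed.

(** The default is never reached: an edge has more than [k.+1] letters and [Sg] at most [k.+1]. *)
Let mk0 (e : seq nat) := head 0 [seq m <- e | m \notin Sg].

Let mk0P e : e \in Es -> mk0 e \in e /\ mk0 e \notin Sg.
Proof.
move=> eE; rewrite /mk0; case E : (filter _ _) => [|m s] /=; last first.
  have : m \in [seq m <- e | m \notin Sg] by rewrite E mem_head.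
  by rewrite mem_filter => /andP[-> ->].
have sub : {subset e <= Sg}.
  move=> m me; apply: contraTT isT => mS; have : m \in [seq m <- e | m \notin Sg] by rewrite mem_filter mS.
  by rewrite E.
have := leq_trans (Esize eE) (uniq_leq_size (Euniq eE) sub).
by rewrite ltnNge size_Sg.
Qed.

Let good_mk0 : good mk0.
Proof.
split=> [e /mk0P[]//|m mS]; right=> e /mk0P[_]; by apply: contraNneq => ->.
Qed.

(* Marking [m] in all the edges that contain it is consistent, whether or not [m] is the value of a variable. *)
Let mkm m e := if m \in e then m else mk0 e.

Let good_mkm m : good (mkm m).
Proof.
split=> [e eE|m' m'S]; first by rewrite /mkm; case: ifP => // _; case: (mk0P eE).
have [->|ne] := eqVneq m' m; [left|right] => e eE; first by rewrite /mkm => ->.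
rewrite /mkm; case: ifP => _; first by rewrite eq_sym.
by case: (mk0P eE) => _; apply: contraNneq => ->.
Qed.

Let bl := c :: map phi q.

Let count_bl (p : pred (seq nat)) : count p bl = p c + count (fun x => p (phi x)) q.
Proof. by rewrite /= count_map. Qed.

Let bl_spec s : s \in bl -> [/\ uniq s, block s & exists2 e, e \in Es & {subset s <= e}].
Proof.
rewrite inE => /orP[/eqP->|/mapP[x xq ->]].
  have [u uU] := U0; split=> //; first exact: uniq_c uU.
  by have [e eE /sub_c] := HU uU; exists e.
have [u uU xu] := var_q xq; split; [exact: uniq_phi xu|exact/block_phi/qk|].
by have [e eE /sub_phi/(_ xu)] := HU uU; exists e.
Qed.

(** Under [mk0] exactly one block of [q] is marked. It is not a single letter, so it determines the
    edge [e0]. Comparison with the choices [mkm m] then counts the occurrences of every letter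
    [m]. *)
Lemma local_edge : exists2 e, e \in Es & forall m, count_mem m (c ++ flatten (map phi q)) = (m \in e).
Proof.
have one0 : count (marked mk0) bl = 1 by rewrite count_bl star.
have [s0 s0bl s0m] : exists2 s, s \in bl & marked mk0 s by apply/hasP; rewrite has_count one0.
have [us0 bs0 _] := bl_spec s0bl.
have /hasP[e0 e0E /andP[/allP s0e0 mk0s0]] := s0m.
have big0 : 1 < size s0.
  case: s0 mk0s0 bs0 {us0 s0e0 s0bl s0m} => [|m [|]] //; rewrite inE => /eqP <- /(_ _ erefl).
  by case: (mk0P e0E) => _ /negbTE->.
exists e0 => // m.
have uq x : x \in q -> uniq (phi x) by case/var_q => u uU; apply: uniq_phi.
have uc : uniq c by have [u /uniq_c] := U0.
rewrite count_cat count_uniq_mem // count_mem_flatten //.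
rewrite -(count_bl (fun s => m \in s)).
(* Under [mkm m] a block is marked because it contains [m], or because of an edge without [m]. These
   exclusive cases add up to one block: the second is [s0] if [m] is not in [e0], and does not
   happen otherwise. *)
pose B s := (m \notin s) && has (fun e => [&& all (mem e) s, m \notin e & mk0 e \in s]) Es.
have split_m s : s \in bl -> marked (mkm m) s = (m \in s) (+) B s.
  case/bl_spec => us bs [e eE se]; rewrite /B; case ms : (m \in s) => /=.
    by apply/hasP; exists e => //; rewrite /mkm (se _ ms) ms andbT; apply/allP.
  apply: eq_in_has => e' e'E /=; rewrite /mkm; case: ifP => me'; rewrite ?ms ?andbF //.
have one : count (fun s => m \in s) bl + count B bl = 1.
  rewrite -(star (good_mkm m)) -count_bl (eq_in_count split_m).
  elim: (bl) => //= s l <-; rewrite /B; case: (m \in s) => /=; lia.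
have [me0|me0] := boolP (m \in e0).
  have := one; have -> : count B bl = 0; last by rewrite addn0.
  apply/eqP; rewrite -leqn0 leqNgt -has_count; apply/hasPn => s sbl; apply/negP => Bs.
  have /andP[_ /hasP[e eE /and3P[/allP se me mks]]] := Bs.
  have sm : marked mk0 s by apply/hasP; exists e => //; rewrite mks andbT; apply/allP.
  move: se; rewrite (count1_inj one0 sbl s0bl sm s0m) => se.
  by move: me; rewrite -(edge_unique e0E eE us0 big0 s0e0 se) me0.
have B0 : B s0.
  apply/andP; split; first by apply: contraNN me0 => /s0e0.
  by apply/hasP; exists e0 => //; rewrite me0 mk0s0 !andbT; apply/allP.
have : 0 < count B bl by rewrite -has_count; apply/hasP; exists s0.
by move: one => /=; lia.
Qed.

Lemma local_is_edge : is_edge (c ++ flatten (map phi q)).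
Proof.
have [e eE H] := local_edge; exists e => //; apply/allP => m _ /=.
by rewrite H count_uniq_mem // Euniq.
Qed.

Lemma local_uniq : uniq q.
Proof.
have [e eE H] := local_edge; apply: count_mem_uniq => x.
have [xq|] := boolP (x \in q); last by move/count_memPn.
have : 0 < count_mem x q by rewrite -has_count has_pred1.
suff : count_mem x q <= 1 by lia.
have [m mx] : exists m, m \in phi x by case: (phi x) (phi0 x) => // m s _; exists m; rewrite mem_head.
have uq y : y \in q -> uniq (phi y) by case/var_q => u uU; apply: uniq_phi.
have := H m; rewrite count_cat count_mem_flatten // => Hm.
have : count_mem x q <= count (fun y => m \in phi y) q by apply: sub_count => y /eqP ->.
by case: (m \in e) Hm => /= Hm; lia.
Qed.

End Local.

Lemma edge_language_implies e :
  (forall q, q \in words e.2 -> counting (words e.1) q) -> bounded k e ->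
  syn_implies (fun _ : unit => is_edge) e.
Proof.
move=> cnt bk T i l r T0 T1 HU q w Hq Hw.
have edge_ctx z : is_edge (l ++ z ++ r) <-> is_edge ((l ++ r) ++ z).
  by split=> -[ee eE H]; exists ee => //; move: H; rewrite -catA ?[z ++ r]perm_catC // (permPl (_ : perm_eq _ (l ++ z ++ r))) // perm_cat2l perm_catC.
pose c n := proj1_sig (constructive_indefinite_description _ (T0 n)).
have Hc n : c n \in T n by rewrite /c; case: constructive_indefinite_description.
have key phi : (forall n, phi n \in T n) ->
    is_edge ((l ++ r) ++ flatten (map phi q)) /\ uniq q.
  move=> phiT; have Hphi u : u \in words e.1 -> is_edge ((l ++ r) ++ flatten (map phi u)).
    by move=> Hu; apply/edge_ctx/(HU u) => //; apply: wsubst_fun.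
  have U0 := words_neq0 e.1.
  have Uk u x : u \in words e.1 -> x \in u -> x < k.
    by move=> Hu Hx; apply: bk Hx; rewrite mem_cat Hu.
  have qk x : x \in q -> x < k by move=> Hx; apply: bk Hx; rewrite mem_cat Hq orbT.
  have phi0 x : phi x != [::] by apply: contraNneq (T1 x) => <-.
  split; first exact: local_is_edge U0 Uk qk (cnt _ Hq) Hphi.
  exact: local_uniq U0 Uk qk (cnt _ Hq) phi0 Hphi.
have [_ uq] := key c Hc.
have [cs Hcs Ew] := (wsubstP _ _ _).1 Hw.
(* No variable is repeated in [q], so independent choices for its positions come from one
   substitution by single words. *)
pose phi n := if n \in q then nth [::] cs (index n q) else c n.
have /andP[/eqP sz Hall] : (size q == size cs) && all (fun p => p.2 \in T p.1) (zip q cs).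
  by move: Hcs; rewrite all2E.
have nthT j : j < size q -> nth [::] cs j \in T (nth 0 q j).
  move=> Hj; have := all_nthP (0, [::]) Hall j; rewrite size_zip sz minnn -sz => /(_ Hj).
  by rewrite nth_zip.
have phiT n : phi n \in T n.
  rewrite /phi; case: ifP => // nq; have := nthT (index n q).
  by rewrite index_mem nq nth_index // => ->.
have [H _] := key phi phiT.
apply/edge_ctx; rewrite Ew; suff -> : cs = map phi q by [].
apply: (@eq_from_nth _ [::]); rewrite ?size_map // -sz => j Hj.
by rewrite (nth_map 0) // /phi mem_nth // index_uniq.
Qed.

End EdgeLanguage.

Lemma tsubst_var t : tsubst tVar t = t.
Proof. by elim: t => //= p -> q ->. Qed.

Lemma syn_holds_words (I : Type) (Wd : I -> seq nat -> Prop) e i : holds (syn Wd) e ->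
  (forall w, w \in words e.1 -> Wd i w) -> forall w, w \in words e.2 -> Wd i w.
Proof.
move=> /(_ (fun n => syn_of Wd (tVar n))); rewrite !eval_syn !tsubst_var => E H w Hw.
have := @syn_of_inj _ _ _ _ i [::] [::] E _ w Hw; rewrite cats0; apply => {Hw}w Hw.
by rewrite cats0; apply: H.
Qed.

(** An orbit that avoids the top for [r] steps repeats a value. Injectivity off the top moves the
    repetition back to [a], and the period, at most the size of [A], divides [r]. *)
Lemma iter_period (A : finType) (f : A -> A) (top a : A) r : f top = top ->
  (forall x y, f x = f y -> f x != top -> x = y) ->
  #|A| <= r -> #|A|`! %| r -> iter r f a != top -> iter r f a = a.
Proof.
move=> f1 finj rA rd alive.
have alive_le i : i <= r -> iter i f a != top.
  move=> ir; apply: contraNneq alive; rewrite -(subnK ir) iterD => ->.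
  by apply/eqP; elim: (r - i) => //= n ->; rewrite f1.
have [i [j [ij jA Eij]]] : exists i j : nat, [/\ i < j, j <= #|A| & iter i f a = iter j f a].
  apply: NNPP => no.
  have inj : injective (fun i : 'I_#|A|.+1 => iter i f a).
    move=> i j E; apply: val_inj; case: (ltngtP i j) => // H; case: no.
      by exists i, j; split; rewrite // -ltnS.
    by exists j, i; split; rewrite // -ltnS.
  by have := leq_card _ inj; rewrite card_ord ltnn.
have period : iter (j - i) f a = a.
  have Hr : i + (j - i) <= r by lia.
  have : iter i f a = iter (i + (j - i)) f a by rewrite subnKC // ltnW.
  move: (j - i) Hr => d; clear - finj alive_le; elim: i => [|i IH] Hr; first by rewrite add0n.
  rewrite addSn !iterS => /finj E; apply: IH; first lia.
  by apply: E; apply: (alive_le i.+1); lia.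
have /dvdnP[q ->] : j - i %| r.
  by apply: dvdn_trans rd; apply: dvdn_fact; lia.
by elim: q => // q IH; rewrite mulSn iterD IH period.
Qed.

(** * Nonfinite basis for flat semilattices *)

Section FlatNFB.
Variables (L : finSemilattice) (top : sl_car L).
Hypothesis flatL : flat top.
Variable k : nat.
Local Notation A := (sl_car L).

(** The factorial serves [iter_period], the other factor makes edges longer than the [k.+1] letters
    that can stand alone. *)
Definition edge_size := #|A|`! * k.+3.
Local Notation r := edge_size.

Lemma edge_size_gt : k.+2 < r.
Proof. by rewrite /r -{1}[k.+3]mul1n leq_mul2r fact_gt0 orbT. Qed.

Lemma edge_size_ge : #|A| <= r.
Proof.
apply: (@leq_trans #|A|`!); last by rewrite leq_pmulr.
by case: #|A| => // n; rewrite factS leq_pmulr // fact_gt0.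
Qed.

Section Edges.
Variables (V E : finType) (ed : E -> 'I_r -> V).
Hypotheses (lin : linear_edges ed) (edinj : forall e, injective (ed e)).
Hypothesis mono : forall c : V -> endo L, exists e, forall i j, c (ed e i) = c (ed e j).

Local Notation X := (V + ('I_r + V * 'I_r * 'I_r))%type.
Definition vertex_letter (x : V) : X := inl x.
Definition end_letter (j : 'I_r) : X := inr (inl j).
Definition fresh_letter (x : V) (j i : 'I_r) : X := inr (inr (x, j, i)).

Definition main_edge (e : E) : seq X := [seq vertex_letter (ed e i) | i <- enum 'I_r].
Definition end_edge : seq X := map end_letter (enum 'I_r).
(* If the variable of [x] is a constant map, this edge forces the variable of [j] to fix its value. *)
Definition link_edge (p : V * 'I_r) : seq X :=
  [seq fresh_letter p.1 p.2 i | i <- enum 'I_r] ++ [:: vertex_letter p.1; end_letter p.2].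

Definition all_edges : seq (seq X) :=
  end_edge :: map main_edge (enum E) ++ map link_edge (enum {: V * 'I_r}).

Lemma all_edgesP (P : seq X -> Prop) : P end_edge -> (forall e, P (main_edge e)) ->
  (forall p, P (link_edge p)) -> forall e, e \in all_edges -> P e.
Proof.
move=> H1 H2 H3 e; rewrite inE mem_cat => /or3P[/eqP->//|/mapP[e' _ ->]//|/mapP[p _ ->]//].
Qed.

Lemma mem_main_edge a e : a \in main_edge e -> exists i, a = vertex_letter (ed e i).
Proof. by case/mapP => i _ ->; exists i. Qed.

Lemma mem_end_edge a : a \in end_edge -> exists j, a = end_letter j.
Proof. by case/mapP => j _ ->; exists j. Qed.

Lemma mem_link_edge a p : a \in link_edge p ->
  [\/ exists i, a = fresh_letter p.1 p.2 i, a = vertex_letter p.1 | a = end_letter p.2].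
Proof.
rewrite mem_cat => /orP[/mapP[i _ ->]|]; first by constructor 1; exists i.
by rewrite !inE => /orP[/eqP->|/eqP->]; [constructor 2 | constructor 3].
Qed.

Lemma all_edges_uniq e : e \in all_edges -> uniq e.
Proof.
move: e; apply: all_edgesP => [|e|p].
- by rewrite map_inj_uniq ?enum_uniq // => i j [].
- by rewrite map_inj_uniq ?enum_uniq // => i j [/edinj].
- rewrite cat_uniq map_inj_uniq ?enum_uniq /=; last by move=> i j [].
  by rewrite orbF andbT; apply/norP; split; apply/mapP => -[].
Qed.

Lemma all_edges_size e : e \in all_edges -> k.+1 < size e.
Proof.
have := edge_size_gt; move: e => + H; apply: all_edgesP => [|e|p].
- by rewrite size_map size_enum_ord ltnW.
- by rewrite size_map size_enum_ord ltnW.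
- by rewrite size_cat size_map size_enum_ord /=; lia.
Qed.

Lemma all_edges_linear e e' a b : e \in all_edges -> e' \in all_edges -> a != b ->
  a \in e -> b \in e -> a \in e' -> b \in e' -> e = e'.
Proof.
move=> eE e'E ab; move: e eE; apply: all_edgesP => [|e|p] ae be; move: e' e'E.
- apply: all_edgesP => [//|e'|p']; have [j1 E1] := mem_end_edge ae; have [j2 E2] := mem_end_edge be.
    by case/mem_main_edge => i; rewrite E1.
  case/mem_link_edge => [[i]||] Ea; rewrite E1 in Ea => //.
  case/mem_link_edge => [[i]||] Eb; rewrite E2 in Eb => //.
  by rewrite E1 E2 Ea Eb eqxx in ab.
- have [i Ei] := mem_main_edge ae; have [j Ej] := mem_main_edge be.
  apply: all_edgesP => [|e'|p'].
  + by case/mem_end_edge => i'; rewrite Ei.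
  + case/mem_main_edge => i'; rewrite Ei => -[Ea]; case/mem_main_edge => j'; rewrite Ej => -[Eb].
    have [-> //|/eqP ne] := eqVneq e e'.
    by rewrite Ei Ej (lin Ea Eb ne) eqxx in ab.
  + case/mem_link_edge => [[i']||] Ea; rewrite Ei in Ea => //.
    case/mem_link_edge => [[j']||] Eb; rewrite Ej in Eb => //.
    by rewrite Ei Ej Ea Eb eqxx in ab.
- apply: all_edgesP => [|e'|p'].
  + case/mem_end_edge => i' Ei; case/mem_end_edge => j' Ej.
    case/mem_link_edge: ae => [[i]||] Ea; rewrite Ei in Ea => //.
    case/mem_link_edge: be => [[i]||] Eb; rewrite Ej in Eb => //.
    by rewrite Ei Ej Ea Eb eqxx in ab.
  + case/mem_main_edge => i' Ei; case/mem_main_edge => j' Ej.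
    case/mem_link_edge: ae => [[i]||] Ea; rewrite Ei in Ea => //.
    case/mem_link_edge: be => [[i]||] Eb; rewrite Ej in Eb => //.
    by rewrite Ei Ej Ea Eb eqxx in ab.
  + case: p p' ae be => [x j] [x' j'] ae be ae' be'.
    case/mem_link_edge: ae => [[i]||] Ea; rewrite Ea in ab ae'.
    * by case/mem_link_edge: ae' => [[i']||] // [-> -> _].
    * case/mem_link_edge: be => [[i]||] Eb; rewrite Eb in ab be'.
      - by case/mem_link_edge: be' => [[i']||] // [-> -> _].
      - by rewrite eqxx in ab.
      by case/mem_link_edge: ae' => [[i']||] // [->]; case/mem_link_edge: be' => [[i']||] // [->].
    * case/mem_link_edge: be => [[i]||] Eb; rewrite Eb in ab be'.
      - by case/mem_link_edge: be' => [[i']||] // [-> -> _].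
      - by case/mem_link_edge: ae' => [[i']||] // [->]; case/mem_link_edge: be' => [[i']||] // [->].
      by rewrite eqxx in ab.
Qed.

Definition code (a : X) : nat := pickle a.
Lemma code_inj : injective code. Proof. exact: pcan_inj pickleK. Qed.

Definition coded_edges : seq (seq nat) := map (map code) all_edges.

Lemma coded_edges_uniq e : e \in coded_edges -> uniq e.
Proof. by case/mapP => e' /all_edges_uniq ue ->; rewrite map_inj_uniq //; apply: code_inj. Qed.

Lemma coded_edges_size e : e \in coded_edges -> k.+1 < size e.
Proof. by case/mapP => e' /all_edges_size ue ->; rewrite size_map. Qed.

Lemma coded_edges_linear e e' m m' : e \in coded_edges -> e' \in coded_edges -> m != m' ->
  m \in e -> m' \in e -> m \in e' -> m' \in e' -> e = e'.
Proof.
case/mapP => f fE ->; case/mapP => f' f'E -> mm' /mapP[a af Em] /mapP[b bf Em'].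
rewrite Em Em' !(mem_map code_inj) => af' bf'; congr (map _ _).
apply: all_edges_linear fE f'E _ af bf af' bf'.
by apply: contraNneq mm' => E1; rewrite Em Em' E1.
Qed.

Definition edge_sum : term := sum_term coded_edges.
Definition end_word : seq nat := map code end_edge.

Lemma end_word_edge : end_word \in coded_edges.
Proof. by rewrite inE eqxx. Qed.

Lemma edge_nonnil e : e \in coded_edges -> e != [::].
Proof. by move/coded_edges_size; case: e. Qed.

Lemma words_edge_sum : words edge_sum =i coded_edges.
Proof. by apply: mem_words_sum_term => //; apply/negP => /edge_nonnil. Qed.

(** In [End L] it says that the end word fixes every value of the sum other than the top. In the
    syntactic semiring it fails, because the end word squared repeats letters and is not an edge. *)
Definition flat_identity : identity :=
  (edge_sum, tAdd edge_sum (tMul edge_sum (term_of end_word))).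

Lemma flat_identity_fails : ~ holds (syn (fun _ : unit => is_edge coded_edges)) flat_identity.
Proof.
move=> /(@syn_holds_words unit _ _ tt) H.
have [||e eE /perm_uniq] := H _ (end_word ++ end_word).
- by move=> w; rewrite words_edge_sum => wE; exists w.
- rewrite mem_cat; apply/orP; right; apply: allpairs_f; first by rewrite words_edge_sum end_word_edge.
  have Hw : end_word \in words (term_of end_word).
    by rewrite words_term_of ?mem_head // edge_nonnil // end_word_edge.
  exact: Hw.
rewrite (coded_edges_uniq eE) cat_uniq => /and3P[_ /hasPn H' _].
have := edge_nonnil end_word_edge; case E1 : end_word => [|m s] // _.
by have := H' m; rewrite E1 mem_head => /(_ isT).
Qed.

Lemma act_constant_letter (v : nat -> endo L) (g : endo L) a u : (forall x, x \in u -> v x = g) ->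
  act v a u = iter (size u) (val g) a.
Proof.
elim: u a => // x u IH a H; rewrite [size _]/= iterSr.
rewrite -IH => [|y yu]; last by apply: H; rewrite inE yu orbT.
by rewrite /act /= (H x) ?mem_head.
Qed.

(** The letters of some main edge all act as the same [g], whose [r]-th iterate sends [a] to [b]. If
    [g] is injective off the top, then [a = b] and the end edge itself fixes [b]. If [g] is
    constant, its value is [b], and the link edges make each end letter fix [b]. *)
Lemma end_word_fixes (v : nat -> endo L) a b : b != top ->
  (forall u, u \in coded_edges -> act v a u = b) -> act v b end_word = b.
Proof.
move=> b_top H; have r0 : 0 < r by have := edge_size_gt; lia.
have [e He] := mono (fun x => v (code (vertex_letter x))).
pose i0 := Ordinal r0; pose g := v (code (vertex_letter (ed e i0))).
have Hmain : iter r (val g) a = b.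
  rewrite -(H (map code (main_edge e))); last first.
    by apply: map_f; rewrite inE mem_cat (map_f _ (mem_enum _ _)) ?orbT // mem_enum.
  have sz : size (map code (main_edge e)) = r by rewrite 2!size_map size_enum_ord.
  rewrite (@act_constant_letter _ g) ?sz // => x.
  by case/mapP => y /mem_main_edge[i ->] ->; apply: He.
have [[b' _ gconst]|[g1 ginj]] := endo_const_or_inj flatL g; last first.
  have ba : b = a.
    rewrite -Hmain; apply: iter_period g1 ginj edge_size_ge _ _; last by rewrite Hmain.
    by rewrite dvdn_mulr.
  by rewrite {1}ba; apply: H; apply: end_word_edge.
have gb x : val g x = b by rewrite gconst -Hmain -(prednK r0) /= gconst.
have fix_end j : val (v (code (end_letter j))) b = b.
  rewrite -[RHS](H (map code (link_edge (ed e i0, j)))); last first.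
    by apply: map_f; rewrite inE mem_cat (map_f link_edge) ?orbT // mem_enum.
  by rewrite map_cat act_cat /act /= -/g gb.
rewrite /end_word /end_edge -map_comp; elim: (enum _) => //= j l IH.
by rewrite /act /= fix_end.
Qed.

Lemma flat_identity_holds : holds (End_ai L) flat_identity.
Proof.
move=> v; pose f : endo L := eval (S := End_ai L) v edge_sum.
pose h : endo L := eval (S := End_ai L) v (term_of end_word).
change (f = endo_add f (endo_mul f h)); apply: endo_eq => a; rewrite !ffunE.
pose b := val f a; rewrite -/b.
have [->|b_top] := eqVneq b top; first by rewrite flat_addTl.
rewrite /h eval_term_of ?edge_nonnil ?end_word_edge // val_wval ?edge_nonnil ?end_word_edge //.
rewrite (@end_word_fixes v a) ?sl_addI // => u uE.
have uw : u \in words edge_sum by rewrite words_edge_sum.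
apply: (flat_le_eq flatL b_top); rewrite -val_wval ?edge_nonnil //.
exact: endo_wval_le uw.
Qed.

End Edges.

Lemma flat_separating_semiring (al be : A) : al != top -> be != top -> al != be ->
  exists (B : aiSemiring) (e : identity),
    [/\ holds (End_ai L) e, ~ holds B e &
        forall e', bounded k e' -> holds (End_ai L) e' -> holds B e'].
Proof.
move=> al_top be_top al_be.
have [V [E [ed [lin edinj mono]]]] := monochromatic_edges r (endo L).
exists (syn (fun _ : unit => is_edge (coded_edges ed))), (flat_identity ed).
split; [exact: flat_identity_holds | exact: flat_identity_fails | move=> e bk He].
apply: syn_holds; apply: (@edge_language_implies k).
- exact: coded_edges_uniq.
- exact: coded_edges_size.
- exact: coded_edges_linear.
- by move=> q; apply: End_counting flatL al_top be_top al_be He.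
- exact: bk.
- exact: coded_edges_uniq.
- exact: coded_edges_size.
- exact: coded_edges_linear.
- by move=> q; apply: End_counting flatL al_top be_top al_be (holds_sym He).
- by move=> u x; rewrite mem_cat orbC -mem_cat; apply: bk.
Qed.

End FlatNFB.

Lemma two_nontop (L : finSemilattice) (top : sl_car L) : 2 < #|sl_car L| ->
  exists al be : sl_car L, [/\ al != top, be != top & al != be].
Proof.
case/card_gt2P => x [y [z [_ [xy yz zx]]]].
have [xt|xt] := eqVneq x top; first by exists y, z; rewrite -xt eq_sym xy zx yz.
have [yt|yt] := eqVneq y top; last by exists x, y.
by exists x, z; rewrite xt -yt eq_sym yz eq_sym zx.
Qed.

Theorem flat_End_NFB (L : finSemilattice) (top : sl_car L) : flat top -> 2 < #|sl_car L| ->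
  ~ finitely_based (End_ai L).
Proof.
move=> flatL /(two_nontop top)[al [be [al_top be_top al_be]]] [Sigma HS].
have [k Hk] := identities_bounded Sigma.
have [B [e [eL eB HB]]] := flat_separating_semiring flatL k al_top be_top al_be.
apply: eB; apply: (HS B).2 eL => e' e'S; apply: HB (Hk _ e'S) _.
exact: in_var_Mod HS _ e'S.
Qed.

(** * The finitely based cases *)

Lemma FB_card1 (L : finSemilattice) : #|sl_car L| = 1 -> finitely_based (End_ai L).
Proof.
move=> /eqP/fintype1P[a Ha]; exists [:: (tVar 0, tVar 1)] => B; split=> [HB e /= [<-|//]|HB e _ v].
  by apply: HB => v; apply: endo_eq => x; apply: etrans (Ha _) (esym (Ha _)).
have := HB (tVar 0, tVar 1) (or_introl erefl) (fun n => if n == 0 then eval v e.1 else eval v e.2).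
exact.
Qed.

Section TwoElements.
Variable B : aiSemiring.
Local Notation "x * y" := (ai_mul x y).
Local Notation "x + y" := (ai_add x y).
Hypothesis mulI : forall x : ai_car B, x * x = x.
Hypothesis mulR : forall x y : ai_car B, x * (y * x) = y * x.
Hypothesis addM : forall x y z : ai_car B, ai_le (x * y) (x + z * y).

Variable v : nat -> ai_car B.
Local Notation wv := (wval v).

Lemma wval_absorb1 x s : x \in s -> v x * wv s = wv s.
Proof.
move=> xs; case/splitPr: xs => s1 s2.
have E : wv (x :: s2) = v x * wv (x :: s2).
  by case: s2 => [|y s2]; rewrite /= ?mulI // ai_mulA mulI.
case: s1 => [|y s1]; first by rewrite cat0s -E.
rewrite wval_cat // {1}E !ai_mulA.
by rewrite -(ai_mulA (v x)) mulR -ai_mulA -E.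
Qed.

Lemma wval_absorb a s : a != [::] -> s != [::] -> {subset a <= s} -> wv a * wv s = wv s.
Proof.
elim: a => // x [|y a] IH _ s0 sub; first by apply: wval_absorb1; apply: sub; rewrite mem_head.
rewrite wval_cons // -ai_mulA IH //; last by move=> z Hz; apply: sub; rewrite inE Hz orbT.
by apply: wval_absorb1; apply: sub; rewrite mem_head.
Qed.

Lemma wval_left a x : exists z, wv (a ++ [:: x]) = z * v x.
Proof.
case: a => [|y a]; first by exists (v x); rewrite mulI.
by exists (wv (y :: a)); rewrite wval_cat.
Qed.

(** With [wv (a ++ [:: x]) = z * v x], [addM] bounds [u x s] by the sum of [u s] and [z x s]. The
    latter equals [a x s' s], as [s] absorbs [s'], and [addM] bounds it by the sum of [a x s'] and
    [u s]. *)
Lemma wval_insert u x s a s' p : u != [::] -> {subset s' <= s} ->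
  ai_le (wv (u ++ s)) p -> ai_le (wv (a ++ x :: s')) p -> ai_le (wv (u ++ x :: s)) p.
Proof.
move=> u0 sub us as'; have [z Ez] := wval_left a x.
have add3 X Y Z : ai_le X p -> ai_le (Z * Y) p -> ai_le (X * Y) p.
  by move=> HX HZ; apply: ai_le_trans (addM _ _ Z) (ai_le_lub HX HZ).
have [s0|s0] := eqVneq s [::].
  have s'0 : s' = [::] by case: s' sub as' => // y s' /(_ y); rewrite s0 mem_head => /(_ isT).
  move: us as'; rewrite s0 s'0 cats0 Ez => us as'.
  by rewrite wval_cat //; apply: add3 as'.
have zxs : ai_le (z * v x * wv s) p.
  have -> : z * v x * wv s = wv (a ++ x :: s') * wv s.
    rewrite -Ez (_ : a ++ x :: s' = (a ++ [:: x]) ++ s'); last by rewrite -catA.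
    have [->|s'0] := eqVneq s' [::]; first by rewrite cats0.
    have ax0 : a ++ [:: x] != [::] by case: (a).
    by rewrite (wval_cat v ax0 s'0) -ai_mulA (wval_absorb s'0 s0 sub).
  by move: us; rewrite wval_cat //; apply: add3.
rewrite wval_cat // wval_cons // ai_mulA.
apply: ai_le_trans (ai_le_mulr _ (addM _ _ z)) _; rewrite ai_mulDl.
by apply: ai_le_lub zxs; rewrite -wval_cat.
Qed.

(** The word [u] is absorbed by [q], so [u q] can replace [q]. Starting from [u], the letters of [q]
    are inserted behind it from right to left; only the last occurrence of a letter needs the second
    hypothesis. *)
Lemma two_words_le t q : q != [::] ->
  (exists2 w, w \in words t & {subset w <= q}) ->
  (forall q1 x s, q = q1 ++ x :: s -> x \notin s ->
     exists a s', a ++ x :: s' \in words t /\ {subset s' <= s}) ->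
  ai_le (wv q) (eval v t).
Proof.
move=> q0 [u ut uq] H; have u0 := words_nonnil ut.
suff main q1 s : q = q1 ++ s -> ai_le (wv (u ++ s)) (eval v t).
  by have := main [::] q erefl; rewrite wval_cat // wval_absorb.
elim: s q1 => [|x s IH] q1 Eq; first by rewrite cats0; apply: wval_le_eval.
have {}IH := IH (rcons q1 x) (etrans Eq (esym (cat_rcons _ _ _))).
have [xs|xs] := boolP (x \in s).
  by rewrite wval_cat // wval_cons ?wval_absorb1 -?wval_cat //; case: (s) xs.
have [a [s' [at' sub]]] := H _ _ _ Eq xs.
exact: wval_insert u0 sub IH (wval_le_eval v at').
Qed.

End TwoElements.

Section TwoElementSemilattice.
Variables (L : finSemilattice) (o i : sl_car L).
Hypotheses (all2 : forall x : sl_car L, x = o \/ x = i) (oi : sl_add o i = i) (neq : o != i).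

Let leo x : sl_le o x.
Proof. by case: (all2 x) => ->; rewrite /sl_le ?sl_addI ?oi. Qed.

Let const_is_endo (a : sl_car L) : is_endo [ffun _ : sl_car L => a].
Proof. by apply/forallP => x; apply/forallP => y; rewrite !ffunE sl_addI. Qed.

Lemma two_endo (f : endo L) :
  [\/ forall x, val f x = x, forall x, val f x = o | forall x, val f x = i].
Proof.
have := endo_hom f o i; rewrite oi.
case: (all2 (val f o)) => Eo; case: (all2 (val f i)) => Ei E.
- by constructor 2 => x; case: (all2 x) => ->.
- by constructor 1 => x; case: (all2 x) => ->.
- by move: E; rewrite Ei Eo sl_addC oi => E; move: neq; rewrite E eqxx.
- by constructor 3 => x; case: (all2 x) => ->.
Qed.

Definition two_basis : list identity :=
  [:: (tMul (tVar 0) (tVar 0), tVar 0);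
      (tMul (tVar 0) (tMul (tVar 1) (tVar 0)), tMul (tVar 1) (tVar 0));
      (tAdd (tMul (tVar 0) (tVar 1)) (tAdd (tVar 0) (tMul (tVar 2) (tVar 1))),
       tAdd (tVar 0) (tMul (tVar 2) (tVar 1)))].

Lemma two_basis_holds : Mod two_basis (End_ai L).
Proof.
have endoP (f g : endo L) : (forall a, val f a = val g a) -> f = g by apply: endo_eq.
move=> e /= [<-|[<-|[<-|//]]] v; apply: endoP => a; rewrite /= ?ffunE /= ?ffunE /= ?ffunE.
- by case: (two_endo (v 0)) => H; rewrite !H.
- by case: (two_endo (v 0)) => H0; case: (two_endo (v 1)) => H1; rewrite ?(H0, H1).
- have oL x : sl_add o x = x by apply/eqP/leo.
  have oR x : sl_add x o = x by rewrite sl_addC.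
  have iL x : sl_add i x = i by case: (all2 x) => ->; rewrite ?oR ?sl_addI.
  have iR x : sl_add x i = i by rewrite sl_addC.
  case: (two_endo (v 0)) => H0; case: (two_endo (v 1)) => H1; case: (two_endo (v 2)) => H2;
    rewrite ?(H0, H1, H2) ?(oL, oR, iL, iR) ?sl_addI //.
Qed.

Let const0 : endo L := endo_of (const_is_endo o).
Let const1 : endo L := endo_of (const_is_endo i).

(** Letters of [q] act as the identity and all others as the constant [o]: a word keeps the state
    [i] exactly when its letters lie in [q]. *)
Lemma two_content e q : holds (End_ai L) e -> q \in words e.2 ->
  exists2 w, w \in words e.1 & {subset w <= q}.
Proof.
move=> H Hq; pose v n := if n \in q then endo_id L else const0.
suff /hasP[w Hw /allP] : has (all (mem q)) (words e.1) by exists w.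
apply: contraT => /hasPn no.
have dead a u : ~~ all (mem q) u -> act v a u = o.
  elim/last_ind: u => // u x IH; rewrite -cats1 all_cat /= andbT negb_and act_cat /act /= /v.
  by case: ifP => _ /=; rewrite ffunE ?orbF // => /IH.
have live u : {subset u <= q} -> act v i u = i.
  elim: u => //= x u IH sub; rewrite /act /= /v sub ?mem_head // ffunE; apply: IH => y yu.
  by apply: sub; rewrite inE yu orbT.
have : sl_le (act v i q) o by apply: endo_holds_le H Hq _ => u /no/dead->; apply: sl_le_refl.
by rewrite live // /sl_le sl_addC oi eq_sym (negbTE neq).
Qed.

(** Letters of [s] act as the identity, [x] as the constant [i], others as the constant [o]: a word
    leads from [o] to [i] only if it has a suffix [x s'] with [s'] over [s]. *)
Lemma two_suffix e q q1 x s : holds (End_ai L) e -> q \in words e.2 ->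
  q = q1 ++ x :: s -> x \notin s ->
  exists a s', a ++ x :: s' \in words e.1 /\ {subset s' <= s}.
Proof.
move=> H Hq Eq xs; pose v n := if n \in s then endo_id L else if n == x then const1 else const0.
have live a u : {subset u <= s} -> act v a u = a.
  elim: u a => //= y u IH a sub; rewrite /act /= /v sub ?mem_head // ffunE; apply: IH => z zu.
  by apply: sub; rewrite inE zu orbT.
have qi : act v o q = i.
  by rewrite Eq act_cat /act /= -/(act _ _ _) live // /v (negbTE xs) eqxx ffunE.
apply: NNPP => no.
have dead u : u \in words e.1 -> act v o u = o.
  move=> Hu; have {no} : forall a s', u = a ++ x :: s' -> ~ {subset s' <= s}.
    by move=> a s' Eu sub; apply: no; exists a, s'; rewrite -Eu.
  elim/last_ind: {Hu} u => // u y IH no.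
  rewrite -cats1 act_cat /act /= -/(act _ _ _) {1}/v; case: ifP => [ys|ys]; rewrite ?ffunE.
    apply: IH => a s' Eu sub; apply: (no a (rcons s' y)); first by rewrite Eu rcons_cat.
    by move=> z; rewrite mem_rcons inE => /orP[/eqP->|/sub].
  case: eqP => [Ey|_]; rewrite ffunE //.
  by case: (no u [::]); rewrite ?Ey ?cats1.
have : sl_le (act v o q) o by apply: endo_holds_le H Hq _ => u /dead->; apply: sl_le_refl.
by rewrite qi /sl_le sl_addC oi eq_sym (negbTE neq).
Qed.

Lemma two_FB : finitely_based (End_ai L).
Proof.
exists two_basis => B; split=> [HB e /two_basis_holds/HB //|HB].
have le_holds e (v : nat -> ai_car B) : holds (End_ai L) e -> ai_le (eval v e.2) (eval v e.1).
  move=> He; apply: eval_lub => q Hq; apply: two_words_le.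
  - by move=> x; apply: (HB _ (or_introl erefl) (fun _ => x)).
  - move=> x y; apply: (HB _ (or_intror (or_introl erefl)) (fun n => if n == 0 then x else y)).
  - move=> x y z.
    exact: (HB _ (or_intror (or_intror (or_introl erefl))) (fun n => if n == 0 then x else if n == 1 then y else z)).
  - exact: words_nonnil Hq.
  - exact: two_content Hq.
  - by move=> q1 x s; apply: two_suffix.
move=> e He v; apply: ai_le_anti; last exact: le_holds.
exact: (le_holds (e.2, e.1) v (holds_sym He)).
Qed.

End TwoElementSemilattice.

Lemma FB_card2 (L : finSemilattice) : #|sl_car L| = 2 -> finitely_based (End_ai L).
Proof.
move=> c2; have /card_gt1P[x [y [_ _ xy]]] : 1 < #|sl_car L| by rewrite c2.
have all2 z : z = x \/ z = y.
  have : z \in [set x; y].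
    rewrite (_ : [set x; y] = setT) ?inE //; apply/eqP; by rewrite eqEcard subsetT cardsT c2 cards2 xy.
  by rewrite !inE => /orP[/eqP|/eqP]; [left | right].
case: (all2 (sl_add x y)) => E; last exact: two_FB all2 E xy.
by apply: (@two_FB L y x); rewrite 1?sl_addC 1?eq_sym // => z; case: (all2 z); [right | left].
Qed.

Import GRing.Theory.
Local Open Scope ring_scope.

(** * The dihedral group of order eight *)

Local Notation F := ('F_2).

(* Upper unitriangular matrices over the field with two elements. *)
Definition heis : Type := (F * F * F)%type.
Definition heis_mul (g h : heis) : heis :=
  (g.1.1 + h.1.1, g.1.2 + h.1.2, g.2 + h.2 + g.1.1 * h.1.2).
Definition heis_one : heis := (0, 0, 0).

(* The action by right multiplication on the cosets of the subgroup of all [(a, 0, 0)]; the coset of [(a, b, c)] is [(b, c - a b)]. *)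
Definition heis_act (s : F * F) (g : heis) : F * F :=
  (s.1 + g.1.2, s.2 + g.2 - g.1.1 * g.1.2 - g.1.1 * s.1).

Lemma heis_act1 s : heis_act s heis_one = s.
Proof. by case: s => b c; rewrite /heis_act /=; congr (_, _); ring. Qed.

Lemma heis_actM s g h : heis_act (heis_act s g) h = heis_act s (heis_mul g h).
Proof. by rewrite /heis_act /heis_mul /=; congr (_, _); ring. Qed.

Lemma heis_act_inj g : injective (heis_act^~ g).
Proof.
move=> [b c] [b' c'] E; have /addIr E1 := congr1 fst E.
have := congr1 snd E; rewrite /= in E1 *; rewrite E1.
by move=> /addIr/addIr/addIr ->.
Qed.

Lemma heis_act_faithful g h : (forall s, heis_act s g = heis_act s h) -> g = h.
Proof.
case: g h => [[a b] c] [[a' b'] c'] H.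
have /= /addrI E1 := congr1 fst (H (0, 0)).
have /= E3 := congr1 snd (H (0, 0)); have /= E2 := congr1 snd (H (1, 0)).
have Ea : a = a'.
  have -> : a = (0 + c - a * b - a * 0) - (0 + c - a * b - a * 1) by ring.
  by rewrite E2 E3; ring.
have Ec : c = (0 + c - a * b - a * 0) + a * b by ring.
by rewrite Ec E3 Ea E1; congr pair; ring.
Qed.

Section HeisInEnd.
Variables (L : finSemilattice) (top : sl_car L).
Hypotheses (flatL : flat top) (big : (4 < #|sl_car L|)%N).
Local Notation A := (sl_car L).

Lemma four_points : exists pt : F * F -> A, injective pt /\ forall s, pt s != top.
Proof.
have le4 : (#|{: F * F}| <= #|predC1 top|)%N.
  rewrite card_prod card_Fp //; have := cardC1 top; have -> : #|predC1 top| = #|[pred x | x != top]| by [].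
  by move=> ->; lia.
exists (fun s => enum_val (widen_ord le4 (enum_rank s))); split=> [s s' /enum_val_inj/(congr1 val) /= /val_inj|s].
  exact: enum_rank_inj.
by have := enum_valP (widen_ord le4 (enum_rank s)).
Qed.

(** The group permutes four points other than the top; sending everything else to the top gives
    endomorphisms. Below a point other than the top the order is equality, so the bound on [q]
    becomes an equation. *)
Lemma End_heis e q (h : nat -> heis) g : holds (End_ai L) e -> q \in words e.2 ->
  (forall u, u \in words e.1 -> mprod heis_mul heis_one h u = g) ->
  mprod heis_mul heis_one h q = g.
Proof.
move=> He Hq HU; have [pt [pt_inj pt_top]] := four_points.
pose rho (g : heis) : {ffun A -> A} :=
  [ffun x => if [pick s | pt s == x] is Some s then pt (heis_act s g) else top].
have rho_pt g' s : rho g' (pt s) = pt (heis_act s g').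
  rewrite ffunE; case: pickP => [s' /eqP/pt_inj->//|/(_ s)]; by rewrite eqxx.
have rho_endo g' : is_endo (rho g').
  apply: (partial_injection_is_endo flatL) => [|x y xy]; rewrite !ffunE.
    by case: pickP => // s /eqP E; have := pt_top s; rewrite E eqxx.
  case: pickP => [s /eqP Es|//]; case: pickP => [s' /eqP Es'|//] /pt_inj/heis_act_inj E.
  by rewrite -Es -Es' E eqxx in xy.
pose v n : endo L := endo_of (rho_endo (h n)).
have actE s u : act v (pt s) u = pt (heis_act s (mprod heis_mul heis_one h u)).
  elim: u s => [|x u IH] s; first by rewrite heis_act1.
  by rewrite -[LHS]/(act v (rho (h x) (pt s)) u) rho_pt IH heis_actM.
apply: heis_act_faithful => s; apply: pt_inj; rewrite -actE.
apply: (flat_le_eq flatL (pt_top _)).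
by apply: endo_holds_le He Hq _ => u Hu; rewrite actE HU // sl_le_refl.
Qed.

End HeisInEnd.

(** * Pairs of positions in a word *)

(** The number of occurrences of [yz] as a scattered subword. *)
Fixpoint pcount (T : eqType) (w : seq T) (y z : T) : nat :=
  if w is x :: w' then ((x == y) * count_mem z w' + pcount w' y z)%N else 0.

Lemma pcount_cat (T : eqType) (w1 w2 : seq T) y z :
  pcount (w1 ++ w2) y z = (pcount w1 y z + pcount w2 y z + count_mem y w1 * count_mem z w2)%N.
Proof. by elim: w1 => [|x w1 IH] /=; rewrite ?addn0 // IH count_cat; lia. Qed.

Lemma count_mem_pair (T1 T2 : eqType) (s0 s : T1) (al : T2) b :
  count_mem (s, al) (map (pair s0) b) = ((s0 == s) * count_mem al b)%N.
Proof.
rewrite count_map -[(s0 == s) : nat]mul1n; case: eqP => [->|ne]; rewrite ?muln0 ?mul1n /= ?mul0n.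
  by apply: eq_count => x /=; rewrite xpair_eqE eqxx.
by elim: b => //= x b ->; rewrite xpair_eqE; case: eqP.
Qed.

Lemma pcount_pair (T1 T2 : eqType) (s0 s s' : T1) (al al' : T2) b :
  pcount (map (pair s0) b) (s, al) (s', al') = ((s0 == s) * (s0 == s') * pcount b al al')%N.
Proof.
elim: b => [|x b IH] /=; first by rewrite muln0.
rewrite IH count_mem_pair xpair_eqE; case: (s0 == s); case: (s0 == s'); case: (x == al) => /=; lia.
Qed.

Lemma pcount_blocks (T1 T2 : eqType) (ls : seq T1) (b : seq T2) s s' al al' :
  pcount (flatten [seq map (pair s0) b | s0 <- ls]) (s, al) (s', al') =
  ((s == s') * count_mem s ls * pcount b al al' + pcount ls s s' * (count_mem al b * count_mem al' b))%N.
Proof.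
elim: ls => [|s0 ls IH] /=; first by rewrite muln0.
have cnt s1 al1 : count_mem (s1, al1) (flatten [seq map (pair s0) b | s0 <- ls]) = (count_mem s1 ls * count_mem al1 b)%N.
  by elim: ls {IH} => //= s2 ls IH; rewrite count_cat IH count_mem_pair mulnDl.
rewrite pcount_cat pcount_pair IH cnt count_mem_pair.
have [->|ne] := eqVneq s0 s; rewrite ?mul0n ?mul1n ?add0n ?addn0; last by lia.
have [->|ne] := eqVneq s s'; lia.
Qed.

Lemma pcount_map (T1 T2 : eqType) (f : T1 -> T2) w y z : injective f ->
  pcount (map f w) (f y) (f z) = pcount w y z.
Proof.
move=> f_inj; elim: w => //= x w ->; rewrite (inj_eq f_inj) count_map; congr (_ * _ + _)%N.
by apply: eq_count => t /=; rewrite (inj_eq f_inj).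
Qed.

Lemma pcount_iota a n y z : pcount (iota a n) y z = ((a <= y < z) && (z < a + n))%N.
Proof.
elim: n a => [|n IH] a /=; first by rewrite addn0; lia.
rewrite IH count_uniq_mem ?iota_uniq // mem_iota.
case: (a =P y) => [->|ne]; rewrite ?mul1n ?mul0n ?add0n; lia.
Qed.

Lemma pcount_enum n (y z : 'I_n) : pcount (enum 'I_n) y z = (y < z)%N.
Proof.
rewrite -(pcount_map _ _ _ val_inj) val_enum_ord pcount_iota /= add0n (ltn_ord z) andbT.
by [].
Qed.

Section Interleave.
Variables (N : nat) (sg : 'I_N -> 'I_N).
Hypothesis sgK : involutive sg.

Definition interleave (l : seq 'I_N) : seq ('I_N * bool) :=
  flatten [seq [:: (sg a, false); (a, true)] | a <- l].

Lemma count_interleave l z (b : bool) :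
  count_mem (z, b) (interleave l) = if b then count_mem z l else count_mem (sg z) l.
Proof.
elim: l => [|a l IH]; first by case: b.
rewrite /interleave /= -/(interleave l) IH !xpair_eqE.
have -> : (sg a == z) = (a == sg z) by rewrite -{2}(sgK a) (inj_eq (inv_inj sgK)).
by case: (b) => /=; rewrite ?andbT ?andbF.
Qed.

Lemma count_interleave_enum z : count_mem z (interleave (enum 'I_N)) = 1%N.
Proof.
case: z => z b; rewrite count_interleave !count_uniq_mem ?enum_uniq // !mem_enum.
by case: b.
Qed.

(** The letter [(c, false)] opens pair [sg c] and [(c, true)] closes pair [c], so a fixed point of
    [sg] does not count. *)
Lemma pcount_interleave c :
  pcount (interleave (enum 'I_N)) (c, true) (c, false) = (c < sg c)%N.
Proof.
rewrite -pcount_enum; elim: (enum _) => // a l IH.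
rewrite /interleave /= -/(interleave l) IH !xpair_eqE /= andbF mul0n add0n andbT.
by rewrite count_interleave.
Qed.

End Interleave.

(** * Groups of class two over the field with two elements *)

Section ClassTwo.
Variables (n : nat) (Lam : {linear 'M[F]_n -> 'M[F]_n}).

(** A central extension of the row space whose cocycle is the image under [Lam] of the universal
    bilinear form. *)
Definition class2 : Type := ('rV[F]_n * 'M[F]_n)%type.
Definition class2_mul (g h : class2) : class2 := (g.1 + h.1, g.2 + h.2 + Lam (g.1^T *m h.1)).
Definition class2_one : class2 := (0, 0).

Lemma class2_mulA : associative class2_mul.
Proof.
move=> [v c] [w d] [x f]; rewrite /class2_mul /=; congr pair; first exact: addrA.
rewrite (linearD (@trmx _ _ _)) /= mulmxDl mulmxDr !(linearD Lam) /=.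
by rewrite [LHS](AC (1*3*2) (1*2*5*3*(6*4))).
Qed.

Lemma class2_mul1g : left_id class2_one class2_mul.
Proof. by move=> [v c]; rewrite /class2_mul /= trmx0 mul0mx linear0 !add0r addr0. Qed.

Lemma class2_cancel2 l r x y :
  class2_mul l (class2_mul x r) = class2_mul l (class2_mul y r) -> x = y.
Proof.
case: l r x y => [vl cl] [vr cr] [vx cx] [vy cy] E.
have /= /addrI/addIr Ev := congr1 fst E; have := congr1 snd E; rewrite /= Ev.
by move=> /addIr/addrI/addIr/addIr ->.
Qed.

Section SmallSubgroup.
Variable k : nat.
Hypothesis Lam_inj : forall (r : nat) (A : 'M[F]_(r, n)) (C : 'M[F]_r),
  (r <= k)%N -> row_free A -> Lam (A^T *m C *m A) = 0 -> C = 0.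

Section Reduce.
Variables (r : nat) (A : 'M[F]_(r, n)).
Hypotheses (rk : (r <= k)%N) (A_free : row_free A).

Definition small_lam (C : 'M[F]_r) : 'M[F]_n := Lam (A^T *m C *m A).

Lemma small_lam_is_linear : linear small_lam.
Proof.
by move=> a C D; rewrite /small_lam mulmxDr mulmxDl -scalemxAr -scalemxAl linearP.
Qed.
HB.instance Definition _ :=
  GRing.isLinear.Build F 'M[F]_r 'M[F]_n *:%R small_lam small_lam_is_linear.

Definition small_inv (c : 'M[F]_n) : 'M[F]_r := vec_mx (mxvec c *m pinvmx (lin_mx small_lam)).

Lemma small_lamK C : small_inv (small_lam C) = C.
Proof.
have free : row_free (lin_mx small_lam).
  apply: inj_row_free => v Hv; apply: (can_inj (@vec_mxK _ _ _)); rewrite linear0.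
  apply: (Lam_inj rk A_free); apply: (can_inj (@mxvecK _ _ _)); rewrite linear0 -Hv.
  by rewrite -/(small_lam _) -mul_vec_lin vec_mxK.
by rewrite /small_inv -mul_vec_lin -mulmxA mulmxVp // mulmx1 mxvecK.
Qed.

Lemma small_invD c d : small_inv (c + d) = small_inv c + small_inv d.
Proof. by rewrite /small_inv !linearD /= mulmxDl linearD. Qed.

Definition small2_mul (g h : 'rV[F]_r * 'M[F]_n) : 'rV[F]_r * 'M[F]_n :=
  (g.1 + h.1, g.2 + h.2 + small_lam (g.1^T *m h.1)).

Lemma small2_class2 g h : ((small2_mul g h).1 *m A, (small2_mul g h).2) =
  class2_mul (g.1 *m A, g.2) (h.1 *m A, h.2).
Proof.
rewrite /class2_mul /small2_mul /= mulmxDl; congr (_, _ + Lam _).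
by rewrite trmx_mul !mulmxA.
Qed.

(** As [small_inv] undoes [small_lam], the cocycle at entry [(al, be)] becomes the product of two
    coordinates, which is the cocycle of [heis]. *)
Definition to_heis (al be : 'I_r) (g : 'rV[F]_r * 'M[F]_n) : heis :=
  (g.1 0 al, g.1 0 be, small_inv g.2 al be).

Lemma to_heisM al be g h :
  to_heis al be (small2_mul g h) = heis_mul (to_heis al be g) (to_heis al be h).
Proof.
rewrite /to_heis /heis_mul /= !small_invD small_lamK; congr (_, _, _); first by rewrite mxE.
  by rewrite mxE.
by rewrite [LHS]mxE [X in X + _]mxE; congr (_ + _ + _); rewrite mxE big_ord1 mxE.
Qed.

(** The part of the centre that [small_inv] does not see is additive. Together with the maps
    [to_heis] it separates all elements. *)
Definition to_center (i j : 'I_n) (g : 'rV[F]_r * 'M[F]_n) : heis :=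
  (0, 0, (g.2 - small_lam (small_inv g.2)) i j).

Lemma to_centerM i j g h :
  to_center i j (small2_mul g h) = heis_mul (to_center i j g) (to_center i j h).
Proof.
rewrite /to_center /heis_mul /= !addr0 mulr0 addr0; congr (_, _, _).
rewrite !small_invD small_lamK !(linearD small_lam) /=.
have E (x y z u v : 'M[F]_n) : x + y + z - (u + v + z) = (x - u) + (y - v).
  by rewrite opprD addrACA subrr addr0 opprD addrACA.
by rewrite E mxE.
Qed.

End Reduce.

(** The first components of [k] elements span a space of dimension at most [k]. In a basis of it,
    the elements live in a group that embeds into a power of [heis], and the claim is checked in
    each coordinate. *)
Lemma class2_implies (U : seq (seq nat)) (q : seq nat) (h : nat -> class2) g :
  (exists u, u \in U) -> (forall u x, u \in U -> x \in u -> (x < k)%N) ->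
  (forall x, x \in q -> (x < k)%N) ->
  (forall (h' : nat -> heis) g', (forall u, u \in U -> mprod heis_mul heis_one h' u = g') ->
     mprod heis_mul heis_one h' q = g') ->
  (forall u, u \in U -> mprod class2_mul class2_one h u = g) ->
  mprod class2_mul class2_one h q = g.
Proof.
move=> [u0 u0U] Uk qk Hheis HU.
pose M := \matrix_(j < k) (h j).1; pose A := row_base M; pose X := col_base M.
have A_free : row_free A := row_base_free M.
have rk : (\rank M <= k)%N := rank_leq_row M.
pose x_ (j : nat) : 'rV[F]_(\rank M) := if insub j is Some j' then row (j' : 'I_k) X else 0.
have xA j : (j < k)%N -> x_ j *m A = (h j).1.
  by move=> jk; rewrite /x_ insubT -row_mul mulmx_base rowK.
pose h' j := (x_ j, (h j).2).
pose P := mprod (small2_mul A) (0, 0) h'.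
pose pi (z : 'rV[F]_(\rank M) * 'M[F]_n) : class2 := (z.1 *m A, z.2).
have piP u : (forall x, x \in u -> (x < k)%N) -> pi (P u) = mprod class2_mul class2_one h u.
  elim: u => [|x u IH] Hu; first by rewrite /pi /= mul0mx.
  rewrite /P /mprod /= -!/(mprod _ _ _ _) -/(P u) -IH; last by move=> y yu; apply: Hu; rewrite inE yu orbT.
  by rewrite /pi small2_class2 /= xA ?Hu ?mem_head // -surjective_pairing.
have pi_inj : injective pi.
  move=> [v c] [w d] E; have /= Ev := congr1 fst E; have /= -> := congr1 snd E.
  by rewrite (row_free_inj A_free Ev).
have PU u : u \in U -> P u = P u0.
  move=> uU; apply: pi_inj; rewrite !piP ?HU //; move=> x; exact: Uk.
suff Eq : P q = P u0 by rewrite -piP // Eq piP ?HU // => x; apply: Uk.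
have homP (f : 'rV[F]_(\rank M) * 'M[F]_n -> heis) : f (0, 0) = heis_one ->
    (forall a b, f (small2_mul A a b) = heis_mul (f a) (f b)) -> f (P q) = f (P u0).
  move=> f1 fM; rewrite (mprod_morph h' q f1 fM); apply: Hheis => u uU.
  by rewrite -(mprod_morph h' u f1 fM) -/(P u) PU.
have inv0 : small_inv A 0 = 0 by rewrite /small_inv linear0 mul0mx linear0.
have Eheis al be : to_heis A al be (P q) = to_heis A al be (P u0).
  by apply: homP => [|a b]; [rewrite /to_heis /= inv0 !mxE | apply: to_heisM].
have Ecenter i j : to_center A i j (P q) = to_center A i j (P u0).
  apply: homP => [|a b]; last exact: to_centerM.
  by rewrite /to_center /= inv0 linear0 subr0 mxE.
have Einv : small_inv A (P q).2 = small_inv A (P u0).2.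
  by apply/matrixP => al be; have := congr1 snd (Eheis al be).
have E1 : (P q).1 = (P u0).1.
  by apply/rowP => al; have := congr1 (fun z => z.1.1) (Eheis al al).
have E2 : (P q).2 = (P u0).2.
  apply/matrixP => i j; have /= := congr1 snd (Ecenter i j).
  by rewrite Einv !mxE => /addIr.
by rewrite [LHS]surjective_pairing E1 E2 -surjective_pairing.
Qed.

End SmallSubgroup.
End ClassTwo.

(** * Words equal in all small semirings but not in the group *)

Section TwistedForm.
Variables k N' : nat.
Local Notation N := N'.+1.

Definition block_letter : finType := ('I_k.+1 * ('I_N * bool))%type.
Local Notation n := #|block_letter|.
Local Notation rk := (@enum_rank block_letter).

Definition corner : 'I_n := rk (ord0, (ord0, true)).
Definition base_trace (m : 'M[F]_n) : F :=
  \sum_(a < N) m (rk (ord0, (a, true))) (rk (ord0, (a, false))).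

(** Its kernel consists of the block scalar matrices whose base block has [base_trace] zero: large
    enough to forget the order inside blocks up to one bit, but of too high rank to be seen by [k]
    elements. *)
Definition twist (m : 'M[F]_n) : 'M[F]_n := \matrix_(i, j)
  (m i j
   - ((enum_val i).1 == (enum_val j).1)%:R * m (rk (ord0, (enum_val i).2)) (rk (ord0, (enum_val j).2))
   + ((i == corner) && (j == corner))%:R * base_trace m).

Lemma twist_is_linear : linear twist.
Proof.
have traceP a m m' : base_trace (a *: m + m') = a * base_trace m + base_trace m'.
  by rewrite /base_trace mulr_sumr -big_split; apply: eq_bigr => c _; rewrite !mxE.
by move=> a m m'; apply/matrixP => i j; rewrite !mxE traceP; ring.
Qed.
HB.instance Definition _ :=
  GRing.isLinear.Build F 'M[F]_n 'M[F]_n *:%R twist twist_is_linear.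

(* If [twist (A^T C A) = 0], the block of [A^T C A] at two fixed second components is a scalar matrix of size [k + 1] and rank at most [r]. *)
Lemma twist_inj (r : nat) (A : 'M[F]_(r, n)) (C : 'M[F]_r) :
  (r <= k)%N -> row_free A -> twist (A^T *m C *m A) = 0 -> C = 0.
Proof.
move=> rk_k A_free; set m := A^T *m C *m A => tw0.
have tw i j : m i j - ((enum_val i).1 == (enum_val j).1)%:R *
    m (rk (ord0, (enum_val i).2)) (rk (ord0, (enum_val j).2))
    + ((i == corner) && (j == corner))%:R * base_trace m = 0.
  by have := congr1 (fun M : 'M_n => M i j) tw0; rewrite !mxE.
have tr0 : base_trace m = 0.
  have := tw corner corner; rewrite !eqxx !mul1r.
  by rewrite {2 3}/corner !enum_rankK /= -/corner subrr add0r.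
have mE s al s' al' : m (rk (s, al)) (rk (s', al')) =
    (s == s')%:R * m (rk (ord0, al)) (rk (ord0, al')).
  by have := tw (rk (s, al)) (rk (s', al')); rewrite !enum_rankK /= tr0 mulr0 addr0 => /subr0_eq.
have base0 al al' : m (rk (ord0, al)) (rk (ord0, al')) = 0.
  apply/eqP; apply: contraT => x0.
  pose P : 'M[F]_(k.+1, r) := \matrix_(s, i) A i (rk (s, al)).
  pose Q : 'M[F]_(r, k.+1) := \matrix_(i, s) A i (rk (s, al')).
  have E : P *m C *m Q = (m (rk (ord0, al)) (rk (ord0, al')))%:M.
    apply/matrixP => s s'; rewrite [RHS]mxE -mulr_natl -mE /m !mxE.
    apply: eq_bigr => i _; rewrite !mxE; congr (_ * _).
    by apply: eq_bigr => j _; rewrite !mxE.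
  have := mxrankM_maxr (P *m C) Q; rewrite E.
  have -> : \rank ((m (rk (ord0, al)) (rk (ord0, al')))%:M : 'M[F]_k.+1) = k.+1.
    by apply: mxrank_unit; rewrite unitmxE det_scalar unitrX // unitfE.
  by have := rank_leq_row Q; lia.
have m0 : m = 0.
  apply/matrixP => i j; rewrite [RHS]mxE -(enum_valK i) -(enum_valK j).
  by case: (enum_val i) (enum_val j) => [s al] [s' al']; rewrite mE base0 mulr0.
rewrite -[C]mulmx1 -(mulmxVp A_free) mulmxA.
have CA : C *m A = 0.
  apply: trmx_inj; apply: (row_free_inj A_free); rewrite trmx0 mul0mx.
  by apply: trmx_inj; rewrite trmx_mul trmxK trmx0 mulmxA -/m.
by rewrite CA mul0mx.
Qed.

Local Notation mul2 := (class2_mul twist).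
Local Notation one2 := (class2_one n).

Definition letter_code (x : block_letter) : nat := rk x.

Definition letter_val (j : nat) : class2 n :=
  if insub j is Some i then (delta_mx 0 i, 0) else one2.

Lemma letter_valE x : letter_val (letter_code x) = (delta_mx 0 (rk x), 0).
Proof. by rewrite /letter_val /letter_code valK. Qed.

Definition letter_prod (w : seq block_letter) : class2 n :=
  mprod mul2 one2 letter_val (map letter_code w).

Lemma letter_prodE w : letter_prod w =
  (\row_j (count_mem (enum_val j) w)%:R,
   twist (\matrix_(i, j) (pcount w (enum_val i) (enum_val j))%:R)).
Proof.
rewrite /letter_prod; elim: w => [|x w IH].
  congr (_, _); first by apply/rowP => j; rewrite !mxE.
  by rewrite (_ : \matrix_(i, j) _ = 0) ?linear0 //; apply/matrixP => i j; rewrite !mxE.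
rewrite /mprod /= -/(mprod _ _ _ _) IH letter_valE /class2_mul /=; congr (_, _).
  apply/rowP => j; rewrite !mxE natrD; congr (_ + _); rewrite eqxx /=.
  by rewrite -(inj_eq enum_rank_inj) enum_valK eq_sym.
rewrite add0r -linearD /=; congr twist; apply/matrixP => i j.
rewrite !mxE big_ord1 !mxE natrD natrM addrC eqxx; congr (_ * _ + _).
by rewrite -(inj_eq enum_rank_inj) enum_valK eq_sym.
Qed.

Section Word.
Variable sg : 'I_N -> 'I_N.
Hypothesis sgK : involutive sg.

Definition block_word : seq block_letter :=
  flatten [seq map (pair s) (interleave sg (enum 'I_N)) | s <- enum 'I_k.+1].

(** The pair counts are those of the interleaving, repeated in each diagonal block, plus one for
    each pair of blocks in order. [twist] cancels the former except for the trace, so the value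
    depends on [sg] only through the parity of the number of [c] with [c < sg c]. *)
Lemma block_word_prod : letter_prod block_word =
  (const_mx 1, \matrix_(i < n, j < n) (((@enum_val block_letter _ i).1 < (@enum_val block_letter _ j).1)%N%:R
     + ((i == corner) && (j == corner))%:R * \sum_(c < N) ((c < sg c)%N)%:R)).
Proof.
have cnt1 m (s : 'I_m) : count_mem s (enum 'I_m) = 1%N.
  by rewrite count_uniq_mem ?enum_uniq // mem_enum.
rewrite letter_prodE; congr (_, _).
  apply/rowP => j; rewrite !mxE; case: (enum_val j) => s al.
  suff -> : count_mem (s, al) block_word = count_mem s (enum 'I_k.+1) by rewrite cnt1.
  rewrite /block_word; elim: (enum 'I_k.+1) => //= s0 ls IH; rewrite count_cat IH count_mem_pair.
  by rewrite count_interleave_enum // muln1.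
have pE s al s' al' : pcount block_word (s, al) (s', al') =
    ((s == s') * pcount (interleave sg (enum 'I_N)) al al' + (s < s'))%N.
  by rewrite pcount_blocks cnt1 !count_interleave_enum // pcount_enum !muln1.
apply/matrixP => i j; rewrite !mxE.
have -> : base_trace (\matrix_(i, j) (pcount block_word (enum_val i) (enum_val j))%:R) =
    \sum_(c < N) ((c < sg c)%N)%:R.
  apply: eq_bigr => c _; rewrite mxE !enum_rankK pE ltnn addn0 eqxx mul1n.
  by rewrite pcount_interleave.
rewrite !enum_rankK; congr (_ + _); case: (enum_val i) (enum_val j) => [s al] [s' al'].
by rewrite !pE /= addn0 mul1n natrD natrM addrAC subrr add0r.
Qed.

End Word.

Lemma tperm_ascents (a b : 'I_N) : (a < b)%N -> \sum_(c < N) ((c < tperm a b c)%N)%:R = 1 :> F.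
Proof.
move=> ab; rewrite (bigD1 a) //= tpermL ab big1 ?addr0 // => c ca.
by case: tpermP => [E|->|_ _]; [rewrite E eqxx in ca | rewrite ltnNge ltnW | rewrite ltnn].
Qed.

Definition swap_words : seq (seq nat) :=
  [seq map letter_code (block_word (tperm x.1 x.2))
     | x : 'I_N * 'I_N <- enum {: 'I_N * 'I_N} & (x.1 < x.2)%N].

Definition plain_word : seq nat := map letter_code (block_word id).

(** A transposition has one ascent and the identity none, so in the group the words of the sum agree
    and [plain_word] differs from them in the corner. In a small semiring [plain_word] has the value
    of one of the others. *)
Definition swap_identity : identity :=
  (sum_term swap_words, tAdd (sum_term swap_words) (term_of plain_word)).

Hypothesis N1 : (0 < N')%N.

Lemma coded_block_word_nonnil sg : map letter_code (block_word sg) != [::].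
Proof. by rewrite /block_word enum_ordSl /= /interleave enum_ordSl. Qed.

Lemma words_swap : words (sum_term swap_words) =i swap_words.
Proof.
apply: mem_words_sum_term; last by apply/mapP => -[x _ /esym/eqP]; apply/negP/coded_block_word_nonnil.
have : map letter_code (block_word (tperm (ord0 : 'I_N) ord_max)) \in swap_words.
  by apply: (map_f (fun x => map letter_code (block_word (tperm x.1 x.2))) (x := (ord0, ord_max)));
    rewrite mem_filter mem_enum /= N1.
by case: swap_words.
Qed.

(* Every element of the group is a target in the sense of [syn_monoid_implies]. *)
Definition class2_language (i : class2 n) (w : seq nat) : Prop :=
  True /\ mprod mul2 one2 letter_val w = i.

Lemma swap_identity_fails : ~ holds (syn class2_language) swap_identity.
Proof.
move=> H; pose i := letter_prod (block_word (tperm (ord0 : 'I_N) ord_max)).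
have plain : plain_word \in words swap_identity.2.
  rewrite /swap_identity [words _]/= mem_cat; apply/orP; right.
  by rewrite words_term_of ?mem_head // coded_block_word_nonnil.
have [w|_ E] := @syn_holds_words _ _ _ i H _ _ plain.
  rewrite words_swap => /mapP[[a b]]; rewrite mem_filter => /andP[/= ab _] ->.
  split=> //; rewrite -/(letter_prod _) /i !block_word_prod; try exact: tpermK.
  by rewrite !tperm_ascents.
have := congr1 (fun z : class2 n => z.2 corner corner) E.
rewrite -/(letter_prod _) /i !block_word_prod //; last exact: tpermK.
rewrite !mxE !eqxx tperm_ascents ?N1 // big1 => [|c _]; last by rewrite ltnn.
by rewrite !mul1r ltnn.
Qed.

Lemma eq_map_wval (B : aiSemiring) (v : nat -> ai_car B) u w :
  map v u = map v w -> wval v u = wval v w.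
Proof.
elim: u w => [|x u IH] [|y w] //= [E1 E2]; have := IH _ E2.
by case: u w E2 {IH} => [|x' u] [|y' w] //= _ ->; rewrite E1.
Qed.

(* Two of the indices are given the same values in all blocks, and interchanging them does not affect the value of the word. *)
Lemma swap_identity_holds (T : aiSemiring) t (f : 'I_t -> ai_car T) (g : ai_car T -> 'I_t) :
  cancel g f -> (t ^ k.+1 * 2 < N)%N -> holds T swap_identity.
Proof.
move=> fK tN v.
pose color (a : 'I_N) := [ffun s : 'I_k.+1 => g (v (letter_code (s, (a, false))))].
have [a [b [ab Eab]]] : exists a b : 'I_N, (a < b)%N /\ color a = color b.
  have [h [h_inj Eh]] : exists h : 'I_2 -> 'I_N, injective h /\ forall i j, color (h i) = color (h j).
    by apply: pigeonhole_inj; rewrite card_ffun !card_ord.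
  have := h_inj ord0 ord_max; case: (ltngtP (h ord0) (h ord_max)) => [lt _|lt _|/val_inj-> /(_ erefl)//].
    by exists (h ord0), (h ord_max).
  by exists (h ord_max), (h ord0).
have Ev s : v (letter_code (s, (a, false))) = v (letter_code (s, (b, false))).
  by apply: (can_inj fK); have := congr1 (fun c : {ffun _} => c s) Eab; rewrite !ffunE.
have val_eq : wval v plain_word = wval v (map letter_code (block_word (tperm a b))).
  apply: eq_map_wval; rewrite -!map_comp /block_word !map_flatten -!map_comp.
  congr flatten; apply: eq_map => s /=; rewrite -!map_comp /interleave !map_flatten -!map_comp.
  congr flatten; apply: eq_map => c /=; congr [:: _; _].
  by case: tpermP => // ->; rewrite Ev.
rewrite /= eval_term_of ?coded_block_word_nonnil // val_eq ai_addC; symmetry.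
apply: wval_le_eval; rewrite words_swap.
by apply: (map_f (fun x => map letter_code (block_word (tperm x.1 x.2))) (x := (a, b)));
  rewrite mem_filter mem_enum /= ab.
Qed.

End TwistedForm.

Theorem flat_End_SNFB (L : finSemilattice) (top : sl_car L) : flat top -> (4 < #|sl_car L|)%N ->
  strongly_nonfinitely_based (End_ai L).
Proof.
move=> flatL big; split; first exact: End_finite.
case=> T [finT [[Sigma HT] TL]]; have [t [f [g fK]]] := finite_ai_enum finT.
have [k Hk] := identities_bounded Sigma.
(* There are [t ^ k.+1] ways to assign values to an index in all blocks, so two indices agree. The
   successor makes [N'] positive even for [t = 0]. *)
pose N' := (t ^ k.+1 * 2).+1.
have [al [be [al_top be_top al_be]]] := @two_nontop L top (ltac:(lia)).
apply: (@swap_identity_fails k N' isT).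
suff HB : Mod Sigma (syn (@class2_language k N')).
  exact: ((HT _).2 HB _ (@swap_identity_holds k N' isT T t f g fK (leqnSn _))).
move=> e eS.
have key e' : bounded k e' -> holds (End_ai L) e' -> syn_implies (@class2_language k N') e'.
  move=> bk He; apply: syn_monoid_implies.
  - exact: class2_mulA.
  - exact: class2_mul1g.
  - exact: class2_cancel2.
  - by move=> q x Hq; apply: counting_mem; apply: End_counting flatL al_top be_top al_be He Hq.
  move=> h l r i _ HU q Hq; have [u0 Hu0] := words_neq0 e'.1.
  rewrite -(HU _ Hu0); congr class2_mul; congr class2_mul.
  apply: (@class2_implies _ _ k _ (words e'.1)).
  - exact: twist_inj.
  - by exists u0.
  - by move=> u x Hu; apply: bk; rewrite mem_cat Hu.
  - by move=> x; apply: bk; rewrite mem_cat Hq orbT.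
  - by move=> h' g'; apply: (End_heis flatL big He Hq).
  - by move=> u Hu; apply: class2_cancel2 (etrans (HU _ Hu) (esym (HU _ Hu0))).
have He := TL _ (in_var_Mod HT eS).
by apply: syn_holds; apply: key; [exact: Hk | | exact: bounded_sym (Hk _ eS) | exact: holds_sym].
Qed.

Local Close Scope ring_scope.

Theorem theorem3p1 (L : finSemilattice) (Hne : 0 < #|sl_car L|) :
  (finitely_based (End_ai L) <-> (#|sl_car L| = 1 \/ #|sl_car L| = 2)) /\
  (3 <= height L -> inherently_nonfinitely_based (End_ai L)) /\
  (5 <= #|sl_car L| -> strongly_nonfinitely_based (End_ai L)).
Proof.
split; [split|split].
- move=> FB; case: (ltnP 2 #|sl_car L|) => [big|]; last by lia.
  case: (ltnP (height L) 3) => [low|high]; last by case: (INFB_not_FB (End_INFB high) FB).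
  by have [top flatL] := low_height_flat Hne low; case: (flat_End_NFB flatL big FB).
- by case=> [/FB_card1|/FB_card2].
- exact: End_INFB.
- case: (ltnP (height L) 3) => [low|high] big; last exact: INFB_SNFB (End_finite L) (End_INFB high).
  by have [top flatL] := low_height_flat Hne low; apply: flat_End_SNFB flatL big.
Qed.
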